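(* Let $\Omega\subset\mathbb R^n$ be open, $t_1<t_2$, and let $f\ge0$ be continuous on $\Omega\times(t_1,t_2)$. Let $\psi:(0,\infty)\to(0,\infty)$ satisfy $\lim_{\varepsilon\to0}\psi(\varepsilon)=\infty$ and $\lim_{\varepsilon\to0}\varepsilon\,\psi(\varepsilon)=0$. A parabolically convex function $u\in C(\Omega\times(t_1,t_2))$ is a viscosity solution of $$-\frac{\partial u}{\partial t}(x,t)\cdot\det D^2u(x,t)=f(x,t)\quad\text{in }\Omega\times(t_1,t_2)$$ if and only if $$u(x,t)=\inf_{\substack{b\det A=1\\ A\le\psi(\varepsilon)I,\ b\le\psi(\varepsilon)}}\left\{\frac{1}{\frac{b^2}{n+2}\varepsilon^2}\int_{t-\frac{b^2}{n+2}\varepsilon^2}^{t}\frac{1}{|B_\varepsilon(0)|}\int_{B_\varepsilon(0)}u(x+Ay,s)\,dy\,ds\right\}-\frac{n+1}{2(n+2)}\big(f(x,t)\big)^{\frac1{n+1}}\varepsilon^2+o(\varepsilon^2)\quad\text{as }\varepsilon\to0,$$ for $x\in\Omega$, $t\in(t_1,t_2)$, in the viscosity sense.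
   Context: A function is parabolically convex if it is continuous, convex in the spatial variable $x$, and non-increasing in $t$. The infimum is over pairs $(A,b)$ with $A$ a symmetric positive definite $n\times n$ matrix and $b>0$ a real number; $A\le\theta I$ means $\theta I-A$ is positive semidefinite. $C^{2,1}$ denotes functions twice continuously differentiable in $x$ and continuously differentiable in $t$. For a constant $c$ and function $g$, ''$c\le g(\varepsilon)+o(\varepsilon^2)$'' means $\lim_{\varepsilon\to0}[c-g(\varepsilon)]^+/\varepsilon^2=0$ and ''$c\ge g(\varepsilon)+o(\varepsilon^2)$'' means $\lim_{\varepsilon\to0}[c-g(\varepsilon)]^-/\varepsilon^2=0$. Viscosity solution: a parabolically convex $u$ is a viscosity solution of $-\partial_tu\det D^2u=f$ if for every $(x,t)\in\Omega\times(t_1,t_2)$ and every parabolically convex $\phi\in C^{2,1}$: (i) if $u-\phi$ has a strict local maximum at $(x,t)$ with $u(x,t)=\phi(x,t)$, then $-\partial_t\phi(x,t)\det D^2\phi(x,t)\ge f(x,t)$; (ii) if $u-\phi$ has a strict local minimum at $(x,t)$ with $u(x,t)=\phi(x,t)$, then $-\partial_t\phi(x,t)\det D^2\phi(x,t)\le f(x,t)$. Asymptotic formula in the viscosity sense: writing the formula as $u(x,t)=M_\varepsilon[u](x,t)+o(\varepsilon^2)$ where $M_\varepsilon[v](x,t)$ denotes the right-hand side expression (infimum of averages plus the $f$ term), it holds in the viscosity sense if for every $(x,t)$ and every parabolically convex $\phi\in C^{2,1}$: (i) if $u-\phi$ has a strict local minimum at $(x,t)$ with $u(x,t)=\phi(x,t)$,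 then $0\ge-\phi(x,t)+M_\varepsilon[\phi](x,t)+o(\varepsilon^2)$; (ii) if $u-\phi$ has a strict local maximum at $(x,t)$ with $u(x,t)=\phi(x,t)$, then $0\le-\phi(x,t)+M_\varepsilon[\phi](x,t)+o(\varepsilon^2)$. *)

(* Defs.v *)
From HB Require Import structures.
From mathcomp Require Import all_boot all_order all_algebra.
From mathcomp Require Import all_classical all_reals all_analysis.
Set Implicit Arguments. Unset Strict Implicit. Unset Printing Implicit Defensive.
Import Order.TTheory GRing.Theory Num.Theory.
Import numFieldNormedType.Exports.
Local Open Scope classical_set_scope.
Local Open Scope ring_scope.

Section Defs.
Variable R : realType.

Definition rvcons n (a : R) (v : 'rV[R]_n) : 'rV[R]_n.+1 :=
  \row_(i < n.+1) match unlift ord0 i with Some j => v ord0 j | None => a end.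

(* Lebesgue integral over R^n, written as the iterated Lebesgue integral
   \int dy_0 \int dy_1 ... \int dy_{n-1} g(y)  (Fubini–Tonelli). *)
Fixpoint iint (n : nat) : ('rV[R]_n -> R) -> \bar R :=
  match n with
  | 0 => fun g => (g 0)%:E
  | n'.+1 => fun g =>
      (\int[@lebesgue_measure R]_(a in setT)
          iint (fun v : 'rV[R]_n' => g (rvcons a v)))%E
  end.

Definition eball n (eps : R) : set 'rV[R]_n :=
  [set y | \sum_(i < n) y ord0 i ^+ 2 < eps ^+ 2].

Definition ball_vol n (eps : R) : R := fine (iint (\1_(@eball n eps))).

(* action of the matrix A on the (column) vector y, written for row vectors *)
Definition mxapp n (A : 'M[R]_n) (y : 'rV[R]_n) : 'rV[R]_n := y *m A^T.

Definition space_avg n (v : 'rV[R]_n -> R -> R) (A : 'M[R]_n) (eps : R)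
    (x : 'rV[R]_n) (s : R) : R :=
  fine (iint (fun y => \1_(@eball n eps) y * v (x + mxapp A y) s)) / @ball_vol n eps.

Definition parab_avg n (v : 'rV[R]_n -> R -> R) (A : 'M[R]_n) (b eps : R)
    (x : 'rV[R]_n) (t : R) : R :=
  let h := b ^+ 2 / n.+2%:R * eps ^+ 2 in
  fine (\int[@lebesgue_measure R]_(s in `[(t - h)%R, t]) (space_avg v A eps x s)%:E)%E / h.

Definition qform n (A : 'M[R]_n) (v : 'rV[R]_n) : R := (v *m A *m v^T) ord0 ord0.

Definition sym_posdef n (A : 'M[R]_n) : Prop :=
  A^T = A /\ forall v : 'rV[R]_n, v != 0 -> 0 < qform A v.

Definition mx_le_scalar n (A : 'M[R]_n) (theta : R) : Prop :=
  forall v : 'rV[R]_n, 0 <= qform (theta%:M - A) v.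

Definition admissible n (psi : R -> R) (eps : R) (A : 'M[R]_n) (b : R) : Prop :=
  sym_posdef A /\ 0 < b /\ b * \det A = 1 /\ mx_le_scalar A (psi eps) /\ b <= psi eps.

Definition Meps n (psi : R -> R) (f : 'rV[R]_n -> R -> R) (v : 'rV[R]_n -> R -> R)
    (eps : R) (x : 'rV[R]_n) (t : R) : R :=
  inf [set r : R | exists (A : 'M[R]_n) (b : R),
                      admissible psi eps A b /\ r = parab_avg v A b eps x t]
  - (n.+1%:R / (2 * n.+2%:R)) * (f x t `^ (n.+1%:R)^-1) * eps ^+ 2.

Definition inD n (Omega : set 'rV[R]_n) (t1 t2 : R) (x : 'rV[R]_n) (t : R) : Prop :=
  Omega x /\ t1 < t < t2.

Definition cont_on n (Omega : set 'rV[R]_n) (t1 t2 : R) (g : 'rV[R]_n -> R -> R) : Prop :=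
  forall x t, inD Omega t1 t2 x t ->
    (fun p : 'rV[R]_n * R => g p.1 p.2) @ (x, t) --> g x t.

Definition parab_convex n (Omega : set 'rV[R]_n) (t1 t2 : R) (g : 'rV[R]_n -> R -> R) : Prop :=
  [/\ cont_on Omega t1 t2 g,
      (forall x y t (l : R), t1 < t < t2 ->
         (forall m : R, 0 <= m <= 1 -> Omega (m *: x + (1 - m) *: y)) ->
         0 <= l <= 1 ->
         g (l *: x + (1 - l) *: y) t <= l * g x t + (1 - l) * g y t) &
      (forall x t s, Omega x -> t1 < t -> t <= s -> s < t2 -> g x s <= g x t)].

Definition dx n (i : 'I_n) (g : 'rV[R]_n -> R -> R) : 'rV[R]_n -> R -> R :=
  fun x t => 'D_(delta_mx ord0 i) (fun y => g y t) x.
Definition dt n (g : 'rV[R]_n -> R -> R) : 'rV[R]_n -> R -> R :=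
  fun x t => 'D_1 (fun s => g x s) t.
Definition hessian n (g : 'rV[R]_n -> R -> R) (x : 'rV[R]_n) (t : R) : 'M[R]_n :=
  \matrix_(i, j) dx i (dx j g) x t.

Definition C21 n (Omega : set 'rV[R]_n) (t1 t2 : R) (g : 'rV[R]_n -> R -> R) : Prop :=
  [/\ forall x t, inD Omega t1 t2 x t ->
        [/\ forall i, derivable (fun y => g y t) x (delta_mx ord0 i),
            forall i j, derivable (fun y => dx j g y t) x (delta_mx ord0 i) &
            derivable (fun s => g x s) t 1],
      cont_on Omega t1 t2 g,
      forall i, cont_on Omega t1 t2 (dx i g),
      forall i j, cont_on Omega t1 t2 (dx i (dx j g)) &
      cont_on Omega t1 t2 (dt g)].

Definition strict_lmax n (Omega : set 'rV[R]_n) (t1 t2 : R) (g : 'rV[R]_n -> R -> R)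
    (x : 'rV[R]_n) (t : R) : Prop :=
  exists r : R, 0 < r /\ forall y s, inD Omega t1 t2 y s ->
    `|y - x| < r -> `|s - t| < r -> (y <> x \/ s <> t) -> g y s < g x t.

Definition strict_lmin n (Omega : set 'rV[R]_n) (t1 t2 : R) (g : 'rV[R]_n -> R -> R)
    (x : 'rV[R]_n) (t : R) : Prop :=
  strict_lmax Omega t1 t2 (fun y s => - g y s) x t.

Definition test_fun n (Omega : set 'rV[R]_n) (t1 t2 : R) (phi : 'rV[R]_n -> R -> R) : Prop :=
  parab_convex Omega t1 t2 phi /\ C21 Omega t1 t2 phi.

Definition visc_sol n (Omega : set 'rV[R]_n) (t1 t2 : R) (f u : 'rV[R]_n -> R -> R) : Prop :=
  parab_convex Omega t1 t2 u /\
  forall x t, inD Omega t1 t2 x t -> forall phi, test_fun Omega t1 t2 phi ->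
    (strict_lmax Omega t1 t2 (fun y s => u y s - phi y s) x t -> u x t = phi x t ->
       f x t <= - dt phi x t * \det (hessian phi x t)) /\
    (strict_lmin Omega t1 t2 (fun y s => u y s - phi y s) x t -> u x t = phi x t ->
       - dt phi x t * \det (hessian phi x t) <= f x t).

(* "c <= g(eps) + o(eps^2)"  :  [c - g(eps)]^+ / eps^2 -> 0 as eps -> 0+ *)
Definition le_plus_o (c : R) (g : R -> R) : Prop :=
  (fun e => Num.max (c - g e) 0 / e ^+ 2) @ 0^'+ --> (0 : R).
(* "c >= g(eps) + o(eps^2)"  :  [c - g(eps)]^- / eps^2 -> 0 as eps -> 0+ *)
Definition ge_plus_o (c : R) (g : R -> R) : Prop :=
  (fun e => Num.max (g e - c) 0 / e ^+ 2) @ 0^'+ --> (0 : R).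

Definition amvp_visc n (Omega : set 'rV[R]_n) (t1 t2 : R) (psi : R -> R)
    (f u : 'rV[R]_n -> R -> R) : Prop :=
  forall x t, inD Omega t1 t2 x t -> forall phi, test_fun Omega t1 t2 phi ->
    (strict_lmin Omega t1 t2 (fun y s => u y s - phi y s) x t -> u x t = phi x t ->
       ge_plus_o 0 (fun e => - phi x t + Meps psi f phi e x t)) /\
    (strict_lmax Omega t1 t2 (fun y s => u y s - phi y s) x t -> u x t = phi x t ->
       le_plus_o 0 (fun e => - phi x t + Meps psi f phi e x t)).

End Defs.

(* Main.v *)
(* For a test function [phi] with Hessian [H] and [c := - phi_t] at [(x, t)], and
   [D := c det H], the quotient [(Meps phi - phi) / eps^2] tends to
   [(n+1) / (2(n+2)) (D^(1/(n+1)) - f^(1/(n+1)))], and both viscosity notions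
   amount to the same sign condition on this limit.

   The average over the ball kills linear terms, so up to [o(eps^2)] the average
   for [(A, b)] is [phi + eps^2 / (2(n+2)) (tr (A H A) + b^2 c)], and Hadamard's
   inequality with AM-GM bounds the bracket below by [(n+1) D^(1/(n+1))] when
   [b det A = 1]. As [A] and [b] may grow with [psi], the error term is not
   uniform; instead [phi] is trapped near [(x, t)] between quadratics with
   [H -/+ m I] and [c -/+ m], which is enough because the trace inequality holds
   for these too. If [D = 0] the lower quadratic is replaced by the affine bound
   given by convexity and monotonicity in [t]. The upper bound is attained at
   the fixed pair with [A] proportional to [(H + m I)^(-1/2)]. *)
Require Import Defs.
From HB Require Import structures.
From mathcomp Require Import all_boot all_order all_algebra.
From mathcomp Require Import all_classical all_reals all_analysis.
From mathcomp Require Import ring lra complex.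
Import Order.TTheory GRing.Theory Num.Theory.
Import numFieldNormedType.Exports.
Local Open Scope classical_set_scope.
Local Open Scope ring_scope.
Set Implicit Arguments. Unset Strict Implicit. Unset Printing Implicit Defensive.

(** * Averages of quadratic polynomials over balls *)

(** A test function is constrained only on [Omega] and [(t1, t2)] and is arbitrary elsewhere, while
    the averages in [Meps] are iterated integrals that make sense for every integrand. Instead of
    proving each inner integral measurable, the proof uses only monotonicity: a function squeezed
    between two quadratics has its average squeezed between theirs, and those are computed exactly.
    The expansion in space is taken about [(x, s)], with the gradient at the running time [s], and
    only the Hessian is frozen at [t]. The linear term then drops out of the ball average for each
    [s], however the gradient depends on time, and the expansion in time is needed only along the
    line over [x], where differentiability at [t] suffices. The common factor [1 / (2(n+2))] has two
    sources: [y_i^2] has mean [eps^2 / (n+2)] over the ball, and [t - s] has mean half the length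
    [b^2 eps^2 / (n+2)] of the time interval. That length is chosen so that the two effects carry
    the same weight and one AM-GM inequality covers both. *)

Section Integral.
Context {R : realType}.
Notation mu := (@lebesgue_measure R).

(* [\int f] is by definition a difference of two suprema over simple functions,
   hence monotone in [f] even for nonmeasurable [f]. *)
Lemma le_integral_nonmeasurable (D : set R) (f g : R -> \bar R) :
  (forall x, D x -> f x <= g x)%E ->
  (\int[mu]_(x in D) f x <= \int[mu]_(x in D) g x)%E.
Proof.
move=> fg; rewrite /integral.
have fgD x : ((f \_ D) x <= (g \_ D) x)%E.
  by rewrite /patch; case: ifPn => // /set_mem /fg.
apply: leeB; apply: ereal_sup_le => _ [h /= hf <-]; exists h => // x;
  apply: (le_trans (hf x)).
- by apply: (@funepos_le _ _ setT) => [y _|]; [exact: fgD|rewrite inE].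
- by apply: (@funeneg_le _ _ setT) => [y _|]; [exact: fgD|rewrite inE].
Qed.

Lemma le_iint n (g1 g2 : 'rV[R]_n -> R) :
  (forall y, g1 y <= g2 y) -> (iint g1 <= iint g2)%E.
Proof.
elim: n g1 g2 => [|n IH] g1 g2 le12 /=; first by rewrite lee_fin.
by apply: le_integral_nonmeasurable => a _; apply: IH.
Qed.

Lemma iint_eq0 n (g : 'rV[R]_n -> R) : (forall y, g y = 0) -> iint g = 0%E.
Proof.
elim: n g => [|n IH] g g0 /=; first by rewrite g0.
by apply: integral0_eq => a _; apply: IH.
Qed.

Lemma FTC2_continuous (f F : R -> R) (a b : R) : a < b ->
  continuous f -> continuous F ->
  (forall x, a < x < b -> is_derive x 1 F (f x)) ->
  (\int[mu]_(x in `[a, b]) (f x)%:E = (F b - F a)%:E)%E.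
Proof.
move=> ab cf cF dF; rewrite (@continuous_FTC2 _ f F) //.
- exact: continuous_subspaceT.
- split.
  + by move=> x; rewrite in_itv/= => /dF [].
  + exact/cvg_at_right_filter/cF.
  + exact/cvg_at_left_filter/cF.
- by move=> x; rewrite in_itv/= derive1E => /dF H; rewrite derive_val.
Qed.

Lemma integrable_continuous_itv (f : R -> R) (a b : R) :
  continuous f -> mu.-integrable `[a, b] (EFin \o f).
Proof.
move=> cf; apply: continuous_compact_integrable; first exact: segment_compact.
exact: continuous_subspaceT.
Qed.

(* The section of the ball of radius [e] at first coordinate [a] is the ball of
   radius [halfchord e a]; it is empty, with radius [0], if [e <= `|a|]. *)
Definition halfchord (e a : R) : R := Num.sqrt (e ^+ 2 - a ^+ 2).

Lemma halfchord_continuous (e : R) : continuous (halfchord e).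
Proof.
move=> a; apply: (@continuous_comp _ _ _ (fun a : R => e ^+ 2 - a ^+ 2) Num.sqrt).
  by apply: cvgB; [exact: cvg_cst|exact: exprn_continuous].
exact: sqrt_continuous.
Qed.

Lemma halfchordX_continuous (e : R) n : continuous (fun a => halfchord e a ^+ n).
Proof.
move=> a; apply: (@continuous_comp _ _ _ (halfchord e) (fun x : R => x ^+ n)).
  exact: halfchord_continuous.
exact: exprn_continuous.
Qed.

Lemma halfchord_gt0 e a : - e < a < e -> 0 < halfchord e a.
Proof. by move=> /andP[? ?]; rewrite sqrtr_gt0; nra. Qed.

Lemma sqr_halfchord e a : - e < a < e -> halfchord e a ^+ 2 = e ^+ 2 - a ^+ 2.
Proof. by move=> /andP[? ?]; rewrite sqr_sqrtr//; nra. Qed.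

Lemma halfchord_end e n : halfchord e e ^+ n.+1 = 0.
Proof. by rewrite /halfchord subrr sqrtr0 expr0n. Qed.

Lemma halfchord_Nend e n : halfchord e (- e) ^+ n.+1 = 0.
Proof. by rewrite /halfchord sqrrN subrr sqrtr0 expr0n. Qed.

(** The exponent [n+2] cancels the pole of the derivative of the square root, so the derivative
    extends continuously to both ends of the interval. *)
Lemma is_derive_halfchordX (e : R) n (a : R) : - e < a < e ->
  is_derive a 1 (fun a => halfchord e a ^+ n.+2)
    (- n.+2%:R * a * halfchord e a ^+ n).
Proof.
move=> ae; have ra := halfchord_gt0 ae.
have dr : is_derive a 1 (halfchord e) (- a / halfchord e a).
  have -> : halfchord e = Num.sqrt \o (fun a => e ^+ 2 - a ^+ 2) by [].
  have d1 : is_derive a 1 (fun a : R => e ^+ 2 - a ^+ 2) (- (2 * a)).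
    apply: is_derive_eq; rewrite /GRing.scale/=. ring.
  have d2 : is_derive (e ^+ 2 - a ^+ 2) 1 (@Num.sqrt R) (2 * halfchord e a)^-1.
    by apply: is_derive1_sqrt; rewrite -sqr_halfchord// exprn_gt0.
  apply: is_derive_eq; rewrite /GRing.scale /= -/(halfchord e a).
  by field; exact: lt0r_neq0.
have -> : (fun a => halfchord e a ^+ n.+2) = (halfchord e : R -> R) ^+ n.+2.
  by apply/funext => x; rewrite exprfctE.
apply: is_derive_eq; rewrite /GRing.scale /= exprS.
by field; exact: lt0r_neq0.
Qed.


(** The Wallis integral of [(1 - a^2)^(n/2)] over [[-1, 1]], which is the ratio of the unit ball
    volumes in dimensions [n+1] and [n]. Only its sign matters, because volumes cancel in
    averages. *)
Definition wallis n : R := fine (\int[mu]_(a in `[(- 1)%R, 1%R]) (halfchord 1 a ^+ n)%:E)%E.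

Lemma integral_halfchordX (e : R) n : 0 < e ->
  (\int[mu]_(a in `[(- e)%R, e]) (halfchord e a ^+ n)%:E = (e ^+ n.+1 * wallis n)%:E)%E.
Proof.
move=> e0; pose F : R -> R := fun x => e * x.
have dF : derive1 F = cst e.
  by apply/funext => x; rewrite derive1E derive_val /GRing.scale/= mulr1.
have := @integration_by_substitution_increasing _ F
  (fun a => halfchord e a ^+ n) (- 1) 1.
have [-> ->] : F (- 1) = - e /\ F 1 = e by rewrite /F mulrN mulr1.
rewrite dF => ->.
- transitivity (\int[mu]_(x in `[(- 1)%R, 1%R])
      ((e ^+ n.+1)%:E * (halfchord 1 x ^+ n)%:E))%E.
    apply: eq_integral => x _; rewrite -EFinM; congr EFin.
    rewrite /halfchord /F !fctE [LHS]mulrC.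
    have -> : e ^+ 2 - (e * x) ^+ 2 = e ^+ 2 * (1 ^+ 2 - x ^+ 2) by ring.
    by rewrite sqrtrM ?sqr_ge0// sqrtr_sqr gtr0_norm// exprMn [in RHS]exprS -mulrA.
  have I1 := integrable_continuous_itv (- 1) 1 (@halfchordX_continuous 1 n).
  by rewrite integralZl//= EFinM /wallis fineK//; exact: integrable_fin_num.
- by lra.
- by move=> x y _ _ xy; rewrite /F ltr_pM2l.
- by move=> x _; exact: cvg_cst.
- exact: is_cvg_cst.
- exact: is_cvg_cst.
- have cF : continuous F by move=> x; apply: cvgM; [exact: cvg_cst|exact: cvg_id].
  split.
  + by move=> x _; rewrite /F.
  + exact/cvg_at_right_filter/cF.
  + exact/cvg_at_left_filter/cF.
- exact/continuous_subspaceT/halfchordX_continuous.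
Qed.

Lemma wallis_gt0 n : 0 < wallis n.
Proof.
have cn := @halfchordX_continuous 1 n.
rewrite -lte_fin /wallis fineK; last first.
  by apply: integrable_fin_num => //; exact: integrable_continuous_itv.
(* On [[-1/2, 1/2]] the half chord is at least [1/2]. *)
apply: (@lt_le_trans _ _ (\int[mu]_(a in `[(- 2^-1)%R, (2^-1)%R]) (2^-1 ^+ n : R)%:E)%E).
  rewrite integral_cst//= lebesgue_measure_itv/= lte_fin.
  rewrite ifT; last by lra.
  by rewrite -EFinB -EFinM lte_fin mulr_gt0 ?exprn_gt0//; lra.
apply: (@le_trans _ _ (\int[mu]_(a in `[(- 2^-1)%R, (2^-1)%R]) (halfchord 1 a ^+ n)%:E)%E).
  apply: le_integral_nonmeasurable => a /=; rewrite in_itv/= => /andP[a1 a2].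
  rewrite lee_fin lerXn2r ?nnegrE ?sqrtr_ge0//.
  rewrite -[2^-1]gtr0_norm; last by lra.
  by rewrite -sqrtr_sqr ler_wsqrtr//; nra.
apply: ge0_subset_integral => //.
- by apply: (measurable_int mu); exact: integrable_continuous_itv.
- by move=> x _; rewrite lee_fin exprn_ge0// sqrtr_ge0.
- by move=> x /=; rewrite !in_itv/= => /andP[? ?]; apply/andP; split; lra.
Qed.

(* With [rho := halfchord e], the integrand is [K * rho^n], [K] the bracket on
   the right-hand side, plus the derivative of
   [- p / (n+2) * rho^(n+2) - s * a * rho^(n+2)] for a suitable [s], and this
   primitive vanishes at both ends. *)
Lemma integral_halfchord_quad n (e al p q T : R) : 0 < e ->
  (\int[mu]_(a in `[(- e)%R, e])
     (halfchord e a ^+ n * (al + p * a + q * a ^+ 2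
        + (e ^+ 2 - a ^+ 2) / n.+2%:R * T))%:E
   = (e ^+ n.+1 * wallis n * (al + e ^+ 2 / n.+3%:R * (q + T)))%:E)%E.
Proof.
move=> e0; set r := halfchord e.
have n2 : n.+2%:R != 0 :> R by rewrite pnatr_eq0.
have n3 : n.+3%:R != 0 :> R by rewrite pnatr_eq0.
have n23 : n.+3%:R = n.+2%:R + 1 :> R by rewrite -natr1.
(* Comparing coefficients of [a^2] gives [s]; the constant terms then force the value of [K]. *)
pose s := (q - T / n.+2%:R) / n.+3%:R.
pose K := al + e ^+ 2 / n.+3%:R * (q + T).
pose g a := r a ^+ n * (p * a - s * (e ^+ 2 - n.+3%:R * a ^+ 2)).
pose G a := - p / n.+2%:R * r a ^+ n.+2 - s * (a * r a ^+ n.+2).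
have cr : continuous r by exact: halfchord_continuous.
have crn m : continuous (fun a => r a ^+ m) by exact: halfchordX_continuous.
have cX : continuous (fun a : R => a ^+ 2) by exact: exprn_continuous.
have cg : continuous g.
  move=> a; apply: cvgM; first exact: crn.
  apply: cvgB; first by apply: cvgM; [exact: cvg_cst|exact: cvg_id].
  apply: cvgM; first exact: cvg_cst.
  apply: cvgB; first exact: cvg_cst.
  by apply: cvgM; [exact: cvg_cst|exact: cX].
have cG : continuous G.
  move=> a; apply: cvgB; apply: cvgM; [exact: cvg_cst|exact: crn|exact: cvg_cst|].
  by apply: cvgM; [exact: cvg_id|exact: crn].
have Ig : (\int[mu]_(a in `[(- e)%R, e]) (g a)%:E = 0)%E.
  apply: (etrans (@FTC2_continuous g G (- e) e _ cg cG _)); [lra| |]; last first.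
    by congr EFin; rewrite /G /r !halfchord_end !halfchord_Nend !mulr0 !subr0.
  move=> a ae; have dr := is_derive_halfchordX n ae.
  rewrite /G; apply: is_derive_eq; rewrite /GRing.scale /= /g -/r.
  have -> : r a ^+ n.+2 = (e ^+ 2 - a ^+ 2) * r a ^+ n.
    by rewrite -sqr_halfchord// -exprD.
  rewrite n23; field; by rewrite -natrD pnatr_eq0.
transitivity (\int[mu]_(a in `[(- e)%R, e]) (K%:E * (r a ^+ n)%:E + (g a)%:E))%E.
  apply: eq_integral => a _; rewrite -EFinM -EFinD; congr EFin.
  rewrite /K /g /s n23; field.
  by rewrite -natrD natr1 !pnatr_eq0.
have Ir := integrable_continuous_itv (- e) e (crn n).
rewrite integralD//=; last 2 first.
- exact: integrableZl.
- exact: integrable_continuous_itv.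
by rewrite integralZl// integral_halfchordX// Ig adde0 -EFinM; congr EFin; rewrite mulrC.
Qed.


Fixpoint unit_ball_vol n : R :=
  if n is n'.+1 then unit_ball_vol n' * wallis n' else 1.

Lemma unit_ball_vol_gt0 n : 0 < unit_ball_vol n.
Proof. by elim: n => [|n IH] /=; rewrite ?mulr_gt0// wallis_gt0. Qed.

(** Coefficients are plain functions and [Q] may be nonsymmetric: fixing the first coordinate then
    stays within the same class, as the induction on the dimension requires. *)
Definition qpoly n (al : R) (p : 'I_n -> R) (Q : 'I_n -> 'I_n -> R)
    (y : 'rV[R]_n) : R :=
  al + \sum_i p i * y ord0 i + \sum_i \sum_j Q i j * (y ord0 i * y ord0 j).

Lemma rvcons0 n (a : R) (v : 'rV[R]_n) : rvcons a v ord0 ord0 = a.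
Proof. by rewrite mxE unlift_none. Qed.

Lemma rvconsS n (a : R) (v : 'rV[R]_n) i : rvcons a v ord0 (lift ord0 i) = v ord0 i.
Proof. by rewrite mxE liftK. Qed.

Lemma qpoly_rvcons n al p Q (a : R) (v : 'rV[R]_n) :
  qpoly al p Q (rvcons a v) =
  qpoly (al + p ord0 * a + Q ord0 ord0 * a ^+ 2)
    (fun i => p (lift ord0 i)
              + a * (Q ord0 (lift ord0 i) + Q (lift ord0 i) ord0))
    (fun i j => Q (lift ord0 i) (lift ord0 j)) v.
Proof.
rewrite /qpoly big_ord_recl rvcons0.
under eq_bigr do rewrite rvconsS.
rewrite [X in _ + X = _]big_ord_recl.
rewrite [X in _ + (X + _) = _]big_ord_recl rvcons0.
under [X in _ + (_ + X + _) = _]eq_bigr do rewrite rvconsS.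
under [X in _ + (_ + X) = _]eq_bigr => i _.
  rewrite big_ord_recl rvcons0 rvconsS.
  under eq_bigr do rewrite rvconsS.
  over.
rewrite big_split/=.
under [X in _ = _ + X + _]eq_bigr do rewrite mulrDl mulrDr mulrDl.
rewrite !big_split/=.
have -> : \sum_i Q ord0 (lift ord0 i) * (a * v ord0 i)
        = \sum_i a * Q ord0 (lift ord0 i) * v ord0 i.
  by apply: eq_bigr => i _; ring.
have -> : \sum_i Q (lift ord0 i) ord0 * (v ord0 i * a)
        = \sum_i a * Q (lift ord0 i) ord0 * v ord0 i.
  by apply: eq_bigr => i _; ring.
ring.
Qed.

Lemma eball_rvcons n (e a : R) (v : 'rV[R]_n) :
  \1_(@eball R n.+1 e) (rvcons a v) = \1_(@eball R n (halfchord e a)) v :> R.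
Proof.
have S0 : 0 <= \sum_(i < n) v ord0 i ^+ 2 by apply: sumr_ge0 => i _; exact: sqr_ge0.
have ES : \sum_(i < n.+1) rvcons a v ord0 i ^+ 2 = a ^+ 2 + \sum_(i < n) v ord0 i ^+ 2.
  by rewrite big_ord_recl rvcons0; under eq_bigr do rewrite rvconsS.
rewrite !indicE; congr ((_ : bool)%:R); apply/idP/idP; rewrite !inE /eball/= ES.
- by move=> h; rewrite sqr_sqrtr; lra.
- have [ea|ea] := lerP 0 (e ^+ 2 - a ^+ 2).
    by rewrite sqr_sqrtr//; lra.
  by rewrite /halfchord ltr0_sqrtr//; lra.
Qed.

(** Slicing at the first coordinate [a] leaves a ball of radius [halfchord e a] and a quadratic in
    the other coordinates. The induction hypothesis integrates the slice, and
    [integral_halfchord_quad] integrates the result over [a]. *)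
Lemma iint_eball_qpoly n (e al : R) p Q : 0 < e ->
  iint (fun y : 'rV[R]_n => \1_(eball e) y * qpoly al p Q y) =
  (unit_ball_vol n * e ^+ n * (al + e ^+ 2 / n.+2%:R * \sum_i Q i i))%:E.
Proof.
elim: n e al p Q => [|n IH] e al p Q e0 /=.
  rewrite /qpoly !big_ord0 indicE mem_set ?mulr0 ?addr0 ?mul1r//.
  by rewrite /eball/= big_ord0 exprn_gt0.
pose T := \sum_i Q (lift ord0 i) (lift ord0 i).
pose h a := halfchord e a ^+ n *
  (al + p ord0 * a + Q ord0 ord0 * a ^+ 2 + (e ^+ 2 - a ^+ 2) / n.+2%:R * T).
have ch : continuous h.
  have cX : continuous (fun a : R => a ^+ 2) by exact: exprn_continuous.
  move=> a; apply: cvgM; first exact: halfchordX_continuous.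
  apply: cvgD; [apply: cvgD; [apply: cvgD|]|].
  - exact: cvg_cst.
  - by apply: cvgM; [exact: cvg_cst|exact: cvg_id].
  - by apply: cvgM; [exact: cvg_cst|exact: cX].
  - apply: cvgM; last exact: cvg_cst.
    by apply: cvgM; [apply: cvgB; [exact: cvg_cst|exact: cX]|exact: cvg_cst].
have Ih := integrable_continuous_itv (- e) e ch.
have Ivh := integrableZl _ (unit_ball_vol n) Ih.
(* The interval is open because the induction hypothesis asks for a positive radius; the endpoints
   form a null set and are put back afterwards. *)
transitivity (\int[mu]_(a in `](- e)%R, e[) ((unit_ball_vol n)%:E * (h a)%:E))%E.
  rewrite [RHS]integral_mkcond; apply: eq_integral => a _; rewrite /patch.
  under eq_fun do rewrite eball_rvcons qpoly_rvcons.
  case: ifPn; rewrite ?notin_setE ?inE/= in_itv/=.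
    move=> ae; rewrite (IH _ _ _ _ (halfchord_gt0 ae)); rewrite -EFinM; congr EFin.
    by rewrite /h sqr_halfchord// -mulrA.
  move=> ae; apply: iint_eq0 => y; rewrite indicE memNset ?mul0r//.
  rewrite /eball/= /halfchord ler0_sqrtr ?expr0n/=; last first.
    by move: ae => /negP; rewrite negb_and -!leNgt => /orP[] ?; nra.
  by apply/negP; rewrite -leNgt sumr_ge0// => i _; exact: sqr_ge0.
rewrite -(@integral_itv_bndoo _ _ _ _ true false); last first.
  apply: measurable_funS (measurable_int mu (Ivh _)) => //.
  exact: subset_itv_oo_cc.
rewrite integralZl//=.
rewrite integral_halfchord_quad// big_ord_recl -/T -EFinM; congr EFin.
by rewrite !mulrA; congr (_ * _); ring.
Qed.


Lemma ball_volE n (e : R) : 0 < e -> ball_vol n e = unit_ball_vol n * e ^+ n.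
Proof.
move=> e0; rewrite /ball_vol.
have -> : \1_(eball e) = (fun y : 'rV[R]_n =>
    \1_(eball e) y * qpoly 1 (fun=> 0) (fun _ _ => 0) y) :> ('rV[R]_n -> R).
  apply/funext => y; rewrite /qpoly big1 => [|i _]; last by rewrite mul0r.
  rewrite big1 => [|i _]; last by rewrite big1// => j _; rewrite mul0r.
  by rewrite !addr0 mulr1.
by rewrite iint_eball_qpoly//= big1// mulr0 addr0 mulr1.
Qed.

(** Real bounds on both sides exclude the infinite values, which [fine] would send to 0. The
    sandwich thus takes the place of an integrability proof. *)
Lemma fine_bounds (lo hi : R) (z : \bar R) :
  (lo%:E <= z)%E -> (z <= hi%:E)%E -> lo <= fine z <= hi.
Proof. by case: z => [r| |]//=; rewrite !lee_fin => -> ->. Qed.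

(** The indicator of the ball kills whatever [v] does elsewhere, so bounds on the ball suffice. The
    linear coefficients [p] and [p'] leave no trace in the result. *)
Lemma space_avg_bounds n (v : 'rV[R]_n -> R -> R) A (e : R) x s
    (al al' : R) p p' Q Q' : 0 < e ->
  (forall y, eball e y ->
     qpoly al p Q y <= v (x + mxapp A y) s <= qpoly al' p' Q' y) ->
  al + e ^+ 2 / n.+2%:R * \sum_i Q i i <= space_avg v A e x s
    <= al' + e ^+ 2 / n.+2%:R * \sum_i Q' i i.
Proof.
move=> e0 vQ; rewrite /space_avg ball_volE//.
have V0 : 0 < unit_ball_vol n * e ^+ n by rewrite mulr_gt0 ?unit_ball_vol_gt0 ?exprn_gt0.
rewrite ler_pdivlMr// ler_pdivrMr// ![_ * (unit_ball_vol n * _)]mulrC.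
apply: fine_bounds; [rewrite -(iint_eball_qpoly _ p _ e0)|
  rewrite -(iint_eball_qpoly _ p' _ e0)];
  apply: le_iint => y; rewrite indicE;
  case: (boolP (y \in eball e)) => [/set_mem /vQ/andP[? ?]|_];
  by rewrite ?mul0r ?mul1r.
Qed.

Lemma integral_affine (K k t h : R) : 0 < h ->
  (\int[mu]_(s in `[(t - h)%R, t]) (K + k * (t - s))%:E
   = (h * (K + k * (h / 2)))%:E)%E.
Proof.
move=> h0; pose G s : R := K * s - k / 2 * (t - s) ^+ 2.
have ct : continuous (fun s : R => t - s).
  by move=> s; apply: cvgB; [exact: cvg_cst|exact: cvg_id].
apply: (etrans (@FTC2_continuous (fun s => K + k * (t - s)) G (t - h) t _ _ _ _)).
- by lra.
- move=> s; apply: cvgD; first exact: cvg_cst.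
  by apply: cvgM; [exact: cvg_cst|exact: ct].
- move=> s; apply: cvgB; first by apply: cvgM; [exact: cvg_cst|exact: cvg_id].
  apply: cvgM; first exact: cvg_cst.
  apply: (@continuous_comp _ _ _ (fun s : R => t - s) (fun x : R => x ^+ 2)).
    exact: ct.
  exact: exprn_continuous.
- move=> s _; rewrite /G.
  by apply: is_derive_eq; rewrite /GRing.scale/=; field.
- by congr EFin; rewrite /G; field.
Qed.

Lemma parab_avg_bounds n (v : 'rV[R]_n -> R -> R) A (b e : R) x t
    (K k K' k' : R) (h := b ^+ 2 / n.+2%:R * e ^+ 2) : 0 < b -> 0 < e ->
  (forall s, t - h <= s <= t ->
     K + k * (t - s) <= space_avg v A e x s <= K' + k' * (t - s)) ->
  K + k * (h / 2) <= parab_avg v A b e x t <= K' + k' * (h / 2).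
Proof.
move=> b0 e0 vK; have h0 : 0 < h by rewrite !mulr_gt0 ?exprn_gt0 ?invr_gt0.
rewrite /parab_avg -/h ler_pdivlMr// ler_pdivrMr// ![_ * h]mulrC.
apply: fine_bounds; rewrite -(integral_affine _ _ t)//;
  apply: le_integral_nonmeasurable => s /=; rewrite in_itv/= => /vK/andP[? ?];
  by rewrite lee_fin.
Qed.

End Integral.

(** * Positive definite matrices *)

Section Matrix.
Context {R : realType}.

Definition sym_possemidef n (H : 'M[R]_n) : Prop :=
  H^T = H /\ forall v : 'rV[R]_n, 0 <= qform H v.

Definition sqnorm n (v : 'rV[R]_n) : R := \sum_i v ord0 i ^+ 2.

Lemma sqnorm_ge0 n (v : 'rV[R]_n) : 0 <= sqnorm v.
Proof. by apply: sumr_ge0 => i _; exact: sqr_ge0. Qed.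

Lemma sqnorm_eq0 n (v : 'rV[R]_n) : (sqnorm v == 0) = (v == 0).
Proof.
apply/idP/eqP => [|->]; last first.
  by rewrite /sqnorm big1// => i _; rewrite mxE expr0n.
rewrite psumr_eq0 => [/allP v0|i _]; last exact: sqr_ge0.
apply/rowP => i; rewrite mxE; apply/eqP.
by have := v0 i (mem_index_enum i); rewrite sqrf_eq0.
Qed.

Lemma sqnorm_gt0 n (v : 'rV[R]_n) : v != 0 -> 0 < sqnorm v.
Proof. by move=> v0; rewrite lt_def sqnorm_eq0 v0 sqnorm_ge0. Qed.

Lemma sqnormE n (v : 'rV[R]_n) : sqnorm v = (v *m v^T) ord0 ord0.
Proof. by rewrite mxE; apply: eq_bigr => i _; rewrite mxE expr2. Qed.

Lemma qformE n (H : 'M[R]_n) v :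
  qform H v = \sum_i \sum_j H i j * (v ord0 i * v ord0 j).
Proof.
rewrite /qform mxE exchange_big/=; apply: eq_bigr => j _.
rewrite !mxE mulr_suml; apply: eq_bigr => i _; ring.
Qed.

Lemma qformD n (H K : 'M[R]_n) v : qform (H + K) v = qform H v + qform K v.
Proof. by rewrite /qform mulmxDr mulmxDl mxE. Qed.

Lemma qformB n (H K : 'M[R]_n) v : qform (H - K) v = qform H v - qform K v.
Proof. by rewrite /qform mulmxBr mulmxBl mxE [X in _ + X]mxE. Qed.

Lemma qform_scalar n (a : R) (v : 'rV[R]_n) : qform a%:M v = a * sqnorm v.
Proof. by rewrite /qform mul_mx_scalar -scalemxAl mxE sqnormE. Qed.

Lemma qform_mulmx n m (A : 'M[R]_(m, n)) (H : 'M[R]_n) v :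
  qform H (v *m A) = qform (A *m H *m A^T) v.
Proof. by rewrite /qform trmx_mul !mulmxA. Qed.

Lemma qformZ n (H : 'M[R]_n) (a : R) v : qform H (a *: v) = a ^+ 2 * qform H v.
Proof.
by rewrite /qform linearZ/= -scalemxAl -scalemxAl -scalemxAr scalerA mxE expr2.
Qed.

Lemma qform_delta n (H : 'M[R]_n) i : qform H (delta_mx ord0 i) = H i i.
Proof. by rewrite /qform -rowE trmx_delta -colE !mxE. Qed.

Lemma delta_mx_neq0 n (i : 'I_n) : delta_mx ord0 i != 0 :> 'rV[R]_n.
Proof.
by apply/eqP => /rowP/(_ i)/eqP; rewrite !mxE !eqxx/= oner_eq0.
Qed.

Lemma posdef_diag_gt0 n (H : 'M[R]_n) i : sym_posdef H -> 0 < H i i.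
Proof. by move=> [_ /(_ _ (delta_mx_neq0 i))]; rewrite qform_delta. Qed.

Lemma possemidefD n (H : 'M[R]_n) (m : R) : 0 < m ->
  sym_possemidef H -> sym_posdef (H + m%:M).
Proof.
move=> m0 [Hs H0]; split; first by rewrite linearD/= tr_scalar_mx Hs.
move=> v v0; rewrite qformD qform_scalar.
by rewrite ltr_wpDl// mulr_gt0// sqnorm_gt0.
Qed.

(* Induction through the Schur complement of the top left entry. *)
Lemma posdef_det_le_prod n (M : 'M[R]_n) : sym_posdef M ->
  0 < \det M <= \prod_i M i i.
Proof.
elim: n M => [|n IH] M [Ms Mp]; first by rewrite det_mx00 big_ord0 ltr01 lexx.
have M00 : 0 < M ord0 ord0 by exact: posdef_diag_gt0.
pose M1 : 'M[R]_(1 + n) := M.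
pose a := M ord0 ord0; pose w := ursubmx M1; pose N := drsubmx M1.
have EM : M1 = block_mx a%:M w w^T N.
  rewrite -[LHS]submxK; congr block_mx.
    by rewrite [LHS]mx11_scalar !mxE !lshift0.
  by rewrite /w trmx_ursub Ms.
pose S := N - a^-1 *: (w^T *m w).
have a0 : a != 0 by rewrite gt_eqF.
have EM' : M1 = block_mx 1%:M 0 (a^-1 *: w^T) 1%:M *m block_mx a%:M w 0 S.
  rewrite EM mulmx_block !mul1mx !mul0mx !addr0.
  congr block_mx; first by rewrite mul_mx_scalar scalerA divff// scale1r.
  by rewrite /S -scalemxAl addrC subrK.
have detM : \det M = a * \det S.
  have -> : \det M = \det (block_mx 1%:M 0 (a^-1 *: w^T) 1%:M)
                      * \det (block_mx a%:M w 0 S) by rewrite -det_mulmx -EM'.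
  by rewrite det_lblock det_ublock !det1 !mul1r det_scalar1.
have Ns : N^T = N by rewrite /N trmx_drsub Ms.
have Sp : sym_posdef S.
  split; first by rewrite /S linearB/= Ns linearZ/= trmx_mul trmxK.
  (* For fixed [v] this [c] minimises the form of [M] at [row_mx c v], and the minimum is the form
     of [S] at [v]. *)
  move=> v v0; pose c : 'rV[R]_1 := - a^-1 *: (v *m w^T).
  have u0 : row_mx c v != 0 :> 'rV_(1 + n).
    by apply: contra v0 => /eqP/(congr1 rsubmx); rewrite row_mxKr raddf0 => ->.
  rewrite /qform; suff <- : row_mx c v *m M1 *m (row_mx c v)^T = v *m S *m v^T by exact: Mp.
  rewrite EM mul_row_block.
  have -> : c *m a%:M + v *m w^T = 0.
    by rewrite mul_mx_scalar scalerA mulrN divff// scaleN1r addNr.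
  rewrite tr_row_mx mul_row_col mul0mx add0r.
  congr (_ *m _).
  by rewrite /c /S mulmxBr -scalemxAl scaleNr addrC -scalemxAr mulmxA.
have /andP[S0 Sle] := IH _ Sp.
rewrite detM mulr_gt0//= big_ord_recl ler_pM2l//.
(* The Schur complement subtracts [w_i^2 / a >= 0] from each remaining diagonal entry. *)
apply: (le_trans Sle); apply: ler_prod => i _; rewrite (ltW (posdef_diag_gt0 i Sp))/=.
rewrite /S !mxE big_ord1 !mxE rshift1 gerBl.
by rewrite mulr_ge0 ?invr_ge0 ?(ltW M00)// -expr2 sqr_ge0.
Qed.

Definition geom_root n (x : R) : R := x `^ (n.+1%:R)^-1.

Lemma geom_root_ge0 n x : 0 <= geom_root n x.
Proof. exact: powR_ge0. Qed.

Lemma geom_rootK n x : 0 <= x -> geom_root n x ^+ n.+1 = x.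
Proof.
move=> x0; rewrite -powR_mulrn ?powR_ge0// -powRrM mulVf ?powRr1//.
Qed.

Lemma geom_root_le n x y : 0 <= x -> 0 <= y ->
  (geom_root n x <= y) = (x <= y ^+ n.+1).
Proof.
move=> x0 y0; rewrite -[in RHS](geom_rootK n x0).
by rewrite ler_pXn2r ?nnegrE ?geom_root_ge0.
Qed.

Lemma le_geom_root n x y : 0 <= x -> 0 <= y ->
  (y <= geom_root n x) = (y ^+ n.+1 <= x).
Proof.
move=> x0 y0; rewrite -[in RHS](geom_rootK n x0).
by rewrite ler_pXn2r ?nnegrE ?geom_root_ge0.
Qed.

Lemma posdef_congr n (H A : 'M[R]_n) : sym_posdef H -> sym_posdef A ->
  sym_posdef (A^T *m H *m A).
Proof.
move=> [Hs Hp] Ap; have As := Ap.1.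
split; first by rewrite !trmx_mul trmxK Hs mulmxA.
move=> v v0; rewrite -{2}[A]trmxK -qform_mulmx; apply: Hp.
have /andP[dA _] := posdef_det_le_prod Ap.
have uA : A \in unitmx by rewrite unitmxE unitfE gt_eqF.
by apply: contra v0 => /eqP vA; rewrite -[v](mulmxK uA) -As vA mul0mx.
Qed.

(** AM-GM is applied to [n+1] numbers, the diagonal entries of [A^T H A] and [b^2 c]. By Hadamard
    their product is at least [b^2 c (det A)^2 det H], which the constraint [b det A = 1] turns into
    [c det H]. *)
Lemma trace_agm n (H A : 'M[R]_n) (b c : R) :
  sym_posdef H -> sym_posdef A -> 0 < b -> 0 < c -> b * \det A = 1 ->
  n.+1%:R * geom_root n (c * \det H) <= \tr (A^T *m H *m A) + b ^+ 2 * c.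
Proof.
move=> Hp Ap b0 c0 bA.
have Mp := posdef_congr Hp Ap; have /andP[Md Mle] := posdef_det_le_prod Mp.
have /andP[Hd _] := posdef_det_le_prod Hp.
set M := _ *m A in Mp Md Mle *.
have dM : \det M = \det A ^+ 2 * \det H.
  by rewrite /M !det_mulmx det_tr; ring.
have bc : 0 < b ^+ 2 * c by rewrite mulr_gt0// exprn_gt0.
pose E (i : 'I_n.+1) := if unlift ord0 i is Some j then M j j else b ^+ 2 * c.
have E0 i : 0 <= E i.
  by rewrite /E; case: unliftP => [j _|_]; rewrite ltW// posdef_diag_gt0.
have trM : 0 <= \tr M by apply: sumr_ge0 => i _; rewrite ltW// posdef_diag_gt0.
have [+ _] := @leif_AGM _ _ 'I_n.+1 E (in1W E0).
rewrite card_ord.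
rewrite big_ord_recl [X in X / _]big_ord_recl /E unlift_none.
under eq_bigr do rewrite liftK.
under [X in (_ + X) / _]eq_bigr do rewrite liftK.
rewrite -/(\tr M) => agm.
rewrite mulrC -ler_pdivlMr// geom_root_le.
- apply: le_trans (le_trans _ agm) _; last by rewrite addrC.
  apply: le_trans (ler_wpM2l (ltW bc) Mle); rewrite dM.
  have -> : b ^+ 2 * c * (\det A ^+ 2 * \det H) = (b * \det A) ^+ 2 * (c * \det H).
    by ring.
  by rewrite bA expr1n mul1r.
- by rewrite mulr_ge0// ltW.
- by rewrite divr_ge0// addr_ge0// ltW.
Qed.

Lemma posdef_det_gt0 n (H : 'M[R]_n) : sym_posdef H -> 0 < \det H.
Proof. by move=> /posdef_det_le_prod/andP[]. Qed.

(** Newton's form: a new node contributes a multiple of the product over the old ones. Repeated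
    nodes are skipped, since eigenvalues may be multiple. *)
Lemma lagrange_interpolation (g : R -> R) (s : seq R) :
  exists p : {poly R}, forall x, x \in s -> p.[x] = g x.
Proof.
elim: s => [|a s [p ps]]; first by exists 0.
have [as_|as_] := boolP (a \in s).
  by exists p => x; rewrite inE => /orP[/eqP ->|]; exact: ps.
pose q : {poly R} := \prod_(z <- s) ('X - z%:P).
have rq x : (q.[x] == 0) = (x \in s) by rewrite -rootE root_prod_XsubC.
exists (p + ((g a - p.[a]) / q.[a])%:P * q) => x.
rewrite hornerD hornerM hornerC inE => /orP[/eqP ->|xs].
  by rewrite divfK ?rq// addrC subrK.
have /eqP -> : q.[x] == 0 by rewrite rq.
by rewrite mulr0 addr0 ps.
Qed.

Lemma trmx_horner_mx n (H : 'M[R]_n.+1) p : H^T = H ->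
  (horner_mx H p)^T = horner_mx H p.
Proof.
move=> Hs; elim/poly_ind: p => [|p c IH]; first by rewrite rmorph0 trmx0.
rewrite rmorphD rmorphM /= horner_mx_X horner_mx_C linearD/= tr_scalar_mx.
congr (_ + _); rewrite -mulmxE trmx_mul IH Hs.
by rewrite -{1}(horner_mx_X H) mulmxE -rmorphM mulrC rmorphM /= horner_mx_X.
Qed.


Lemma mulmx_conj (F : fieldType) n (P X Y : 'M[F]_n) : P \in unitmx ->
  (invmx P *m X *m P) *m (invmx P *m Y *m P) = invmx P *m (X *m Y) *m P.
Proof. by move=> uP; rewrite -!mulmxA (mulKVmx uP). Qed.

Lemma horner_mx_diag_conj (F : fieldType) n (P : 'M[F]_n.+1) d p : P \in unitmx ->
  horner_mx (invmx P *m diag_mx d *m P) p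
  = invmx P *m diag_mx (map_mx (horner p) d) *m P.
Proof. by move=> uP; rewrite horner_mx_uconjC// horner_mx_diag. Qed.

(* The fourth root [B] of [H^-1] is a real polynomial in [H] interpolating
   [r |-> r^(-1/4)] on the spectrum, so that [B *m B] is positive definite. *)
Lemma posdef_invsqrt n (H : 'M[R]_n) : sym_posdef H ->
  exists2 A, sym_posdef A & A *m H *m A = 1%:M.
Proof.
case: n H => [|n] H [Hs Hp].
  exists 0; last by rewrite mulmx0; apply/matrixP => -[].
  split; first by rewrite trmx0.
  by move=> v /negP []; apply/eqP/rowP => -[].
pose f := real_complex R.
have [P [d [uP HCE dR]]] : exists P d, [/\ P \in unitmx,
    map_mx f H = invmx P *m diag_mx d *m P & forall i, d ord0 i \is Num.real].
  have HCh : map_mx f H \is hermsymmx.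
    apply: realsym_hermsym.
      apply/is_hermitianmxP; rewrite expr0 scale1r map_mx_id//.
      by apply/matrixP => i j; rewrite !mxE -{1}Hs mxE.
    by apply/mxOverP => i j; rewrite mxE; apply/complex_realP; exists (H i j).
  exists (spectralmx (map_mx f H)), (spectral_diag (map_mx f H)); split.
  - exact: spectral_unit.
  - exact/orthomx_spectralP/hermitian_normalmx.
  - by move=> i; exact: (mxOverP (hermitian_spectral_diag_real HCh)).
pose r i := complex.Re (d ord0 i).
have dr i : d ord0 i = f (r i) by rewrite /f RRe_real.
have r0 i : 0 < r i.
  have : eigenvalue (map_mx f H) (f (r i)).
    apply/eigenvalueP; exists (row i P).
      rewrite {1}HCE -row_mul !mulmxA mulmxV// mul1mx row_mul.
      by rewrite row_diag_mx -dr -scalemxAl -rowE.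
    apply/eqP => /(congr1 (mulmx^~ (invmx P))).
    rewrite -row_mul mulmxV// mul0mx => /rowP/(_ i)/eqP.
    by rewrite !mxE eqxx oner_eq0.
  (* Being real, the eigenvalue is a root of the real characteristic polynomial, hence has a real
     eigenvector, on which the positivity of [H] can be tested. *)
  rewrite eigenvalue_root_char -map_char_poly fmorph_root -eigenvalue_root_char.
  move=> /eigenvalueP[v vH v0]; have := Hp _ v0.
  rewrite /qform vH -scalemxAl mxE -sqnormE.
  by rewrite pmulr_lgt0// sqnorm_gt0.
have [q qr] := lagrange_interpolation (fun x => (Num.sqrt (Num.sqrt x))^-1)
  [seq r i | i : 'I_n.+1].
pose B := horner_mx H q.
have Bs : B^T = B by exact: trmx_horner_mx.
have HB : (B *m B) *m H *m (B *m B) = 1%:M.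
  apply: (map_mx_inj (f := f)); rewrite map_mx1 !map_mxM/=.
  have -> : map_mx f B = invmx P *m diag_mx (map_mx (horner (map_poly f q)) d) *m P.
    by rewrite -(horner_mx_diag_conj _ _ uP) -HCE; exact: map_horner_mx.
  rewrite HCE; set D := diag_mx (map_mx _ _).
  rewrite (mulmx_conj D D uP) (mulmx_conj _ (diag_mx d) uP) (mulmx_conj _ _ uP).
  suff -> : D *m D *m diag_mx d *m (D *m D) = 1%:M by rewrite mulmx1 mulVmx.
  rewrite /D !mulmx_diag -[in RHS]diag_const_mx; congr diag_mx.
  apply/rowP => i; rewrite !mxE dr horner_map qr; last exact: map_f (mem_enum _ i).
  rewrite -!rmorphM/= -(rmorph1 f); congr f.
  have s0 : 0 < Num.sqrt (Num.sqrt (r i)) by rewrite !sqrtr_gt0.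
  rewrite -{3}[r i]sqr_sqrtr ?ltW// -{3}[Num.sqrt (r i)]sqr_sqrtr ?sqrtr_ge0//.
  by field; exact: lt0r_neq0.
exists (B *m B) => //; split; first by rewrite trmx_mul Bs.
have uB : B \in unitmx.
  have : \det (B *m B *m H *m (B *m B)) != 0 by rewrite HB det1 oner_eq0.
  rewrite !det_mulmx unitmxE unitfE.
  by apply: contraNneq => ->; rewrite !(mul0r, mulr0).
have -> : B *m B = B *m 1%:M *m B^T by rewrite mulmx1 Bs.
move=> v v0; rewrite -qform_mulmx qform_scalar mul1r.
by apply: sqnorm_gt0; apply: contra v0 => /eqP vB; rewrite -[v](mulmxK uB) vB mul0mx.
Qed.

(** Equality in AM-GM requires all [n+1] numbers to coincide. With [A = l H^(-1/2)] and
    [b = l / sqrt c] each of them is [l^2], and [b det A = 1] forces [l^2] to be the root [L]. The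
    constraint is checked after squaring, both sides being nonnegative. *)
Lemma posdef_trace_agm_eq n (H : 'M[R]_n) (c : R) : sym_posdef H -> 0 < c ->
  exists A b, [/\ sym_posdef A, 0 < b, b * \det A = 1 &
    \tr (A^T *m H *m A) + b ^+ 2 * c = n.+1%:R * geom_root n (c * \det H)].
Proof.
move=> Hp c0; have [A0 A0p A0H] := posdef_invsqrt Hp.
have H0 := posdef_det_gt0 Hp; have A00 := posdef_det_gt0 A0p.
have dA0 : \det A0 ^+ 2 * \det H = 1.
  by rewrite -(det1 R n) -A0H !det_mulmx; ring.
have cH : 0 < c * \det H by rewrite mulr_gt0.
set L := geom_root n _; have L0 : 0 < L by apply: powR_gt0.
have LK : L ^+ n.+1 = c * \det H by rewrite geom_rootK// ltW.
pose l := Num.sqrt L; have l0 : 0 < l by rewrite sqrtr_gt0.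
have ll : l ^+ 2 = L by rewrite sqr_sqrtr// ltW.
pose s := Num.sqrt c; have s0 : 0 < s by rewrite sqrtr_gt0.
have ss : s ^+ 2 = c by rewrite sqr_sqrtr// ltW.
have sn0 := lt0r_neq0 s0.
exists (l *: A0), (l / s); split.
- split; first by rewrite linearZ/= A0p.1.
  move=> v /A0p.2; rewrite /qform -scalemxAr -scalemxAl [in X in _ -> X]mxE => ?.
  exact: mulr_gt0.
- exact: divr_gt0.
- rewrite detZ; apply/eqP; rewrite -(@eqrXn2 _ 2)//; last first.
    by rewrite !mulr_ge0 ?invr_ge0 ?exprn_ge0 ?ltW.
  have -> : (l / s * (l ^+ n * \det A0)) ^+ 2
    = (l ^+ 2) ^+ n.+1 * \det A0 ^+ 2 / s ^+ 2.
    by rewrite -!exprM mulnC exprM [l ^+ n.+1]exprS; field.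
  rewrite ll LK ss expr1n; apply/eqP; rewrite -[RHS]dA0.
  by field; rewrite gt_eqF.
- rewrite [(l *: A0)^T]linearZ/= A0p.1 -!scalemxAl -scalemxAr A0H scalerA -expr2 ll.
  rewrite linearZ/= mxtrace1 exprMn exprVn ss ll divfK ?gt_eqF//.
  by rewrite -natr1; ring.
Qed.

(** Lagrange's identity: twice the difference is the double sum of
    [(x i * y j - x j * y i) ^+ 2]. *)
Lemma cauchy_schwarz n (x y : 'I_n -> R) :
  (\sum_i x i * y i) ^+ 2 <= (\sum_i x i ^+ 2) * (\sum_i y i ^+ 2).
Proof.
have E (F G : 'I_n -> R) :
    (\sum_i F i) * (\sum_j G j) = \sum_i \sum_j F i * G j.
  by rewrite mulr_suml; apply: eq_bigr => i _; rewrite mulr_sumr.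
rewrite expr2 E -(ler_pM2l (ltr0n R 2)) mulr2n mulrDl !mul1r.
rewrite [in leRHS]mulrDl !mul1r -{2}[_ * _]mulrC !E -!big_split/=.
apply: ler_sum => i _; rewrite -!big_split/=; apply: ler_sum => j _.
by have := sqr_ge0 (x i * y j - x j * y i); nra.
Qed.

(** Writing [w = u A] with [A = H^(-1/2)] turns the form into [sqnorm u], while [sqnorm (u A)] is at
    most [sqnorm u] times the squared Frobenius norm of [A]. The [1 +] in [C] keeps it positive in
    dimension 0 too. *)
Lemma posdef_coercive n (H : 'M[R]_n) : sym_posdef H ->
  exists2 m : R, 0 < m & forall w, m * sqnorm w <= qform H w.
Proof.
move=> Hp; have [A Ap AH] := posdef_invsqrt Hp.
have uA : A \in unitmx by rewrite unitmxE unitfE gt_eqF// posdef_det_gt0.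
pose C := 1 + \sum_i \sum_j A j i ^+ 2.
have C0 : 0 < C.
  by rewrite ltr_pwDl// sumr_ge0// => i _; apply: sumr_ge0 => j _; exact: sqr_ge0.
exists C^-1 => [|w]; first by rewrite invr_gt0.
rewrite mulrC ler_pdivrMr// -[w](mulmxKV uA); set u := w *m _.
rewrite qform_mulmx Ap.1 AH qform_scalar mul1r.
apply: (@le_trans _ _ (sqnorm u * \sum_i \sum_j A j i ^+ 2)); last first.
  by rewrite ler_wpM2l ?sqnorm_ge0// lerDr.
rewrite mulr_sumr; apply: ler_sum => i _; rewrite mxE; exact: cauchy_schwarz.
Qed.

Lemma posdefB n (H : 'M[R]_n) : sym_posdef H ->
  exists2 m : R, 0 < m & forall e, 0 < e -> e < m -> sym_posdef (H - e%:M).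
Proof.
move=> Hp; have [m m0 mH] := posdef_coercive Hp; exists m => // e e0 em.
split; first by rewrite linearB/= tr_scalar_mx Hp.1.
move=> v v0; rewrite qformB qform_scalar subr_gt0.
by apply: lt_le_trans (mH v); rewrite ltr_pM2r// sqnorm_gt0.
Qed.

Lemma det_addscalar_cvg n (H : 'M[R]_n) : \det (H + e%:M) @[e --> 0] --> \det H.
Proof.
have E : \det H = \det (H + 0%:M) by rewrite raddf0 addr0.
rewrite [X in _ --> X]E.
(* The determinant unfolds to the Leibniz sum, so continuity of finite sums and products is
   enough. *)
apply: cvg_big => [x|s _]; first exact: add_continuous.
apply: cvgM; first exact: cvg_cst.
apply: cvg_big => [x|i _]; first exact: mul_continuous.
under eq_fun do rewrite !mxE; rewrite !mxE.
apply: cvgD; first exact: cvg_cst.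
by case: eqP => _; rewrite ?mulr1n ?mulr0n; [exact: cvg_id|exact: cvg_cst].
Qed.

Lemma possemidef_det_ge0 n (H : 'M[R]_n) : sym_possemidef H -> 0 <= \det H.
Proof.
move=> Hp; have dH := @cvg_at_right_filter _ _ _ _ _ (@det_addscalar_cvg _ H).
rewrite -(cvg_lim _ dH)//; apply: limr_ge; first by apply/cvg_ex; exists (\det H).
near=> e; apply/ltW/posdef_det_gt0/possemidefD => //.
Unshelve. all: by end_near. Qed.

(** If the form vanished at some [v != 0], then [w = v H] would be nonzero by invertibility, and
    moving from [v] slightly against [w] would make the form negative, the first-order term being
    [2 t sqnorm w]. *)
Lemma possemidef_posdef n (H : 'M[R]_n) : sym_possemidef H -> \det H != 0 ->
  sym_posdef H.
Proof.
move=> [Hs Hp] dH; split => // v v0; rewrite lt_def Hp andbT.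
have uH : H \in unitmx by rewrite unitmxE unitfE.
apply/eqP => q0; pose w := v *m H.
have w0 : 0 < sqnorm w.
  by apply: sqnorm_gt0; apply: contra v0 => /eqP vH; rewrite -[v](mulmxK uH) -/w vH mul0mx.
have q (t : R) : qform H (v + t *: w) = 2 * t * sqnorm w + t ^+ 2 * qform H w.
  have Hwv : w *m H *m v^T = w *m w^T by rewrite [in RHS]/w trmx_mul Hs mulmxA.
  rewrite /qform linearD linearZ /= !mulmxDl !mulmxDr -/w.
  rewrite -!scalemxAl -!scalemxAr Hwv sqnormE.
  move: q0; rewrite /qform -/w.
  move: (w *m v^T) (w *m w^T) (w *m H *m w^T) => a b c a0.
  by rewrite !mxE a0; ring.
(* The minimiser would be [t = - N / Q]; [Q + 1] avoids a division by zero and still gives a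
   negative value. *)
have := Hp (v + (- (sqnorm w / (qform H w + 1))) *: w); rewrite q.
have Q0 := Hp w; move: (sqnorm w) (qform H w) w0 Q0 => N Q N0 Q0.
apply/negP; rewrite -ltNge.
have -> : 2 * - (N / (Q + 1)) * N + (- (N / (Q + 1))) ^+ 2 * Q
   = - (N ^+ 2 / (Q + 1) ^+ 2) * (Q + 2).
  by field; rewrite gt_eqF//; lra.
rewrite mulNr oppr_lt0 !mulr_gt0 ?invr_gt0 ?exprn_gt0//; lra.
Qed.

(** Off the diagonal, [th I - A] is tested on [e_i + e_j] and [e_i - e_j], and the positive diagonal
    entries of [A] are dropped. This converts the matrix constraint into a bound on the
    displacements [mxapp A y]. *)
Lemma entry_le_scalar n (A : 'M[R]_n) (th : R) i j :
  sym_posdef A -> mx_le_scalar A th -> `|A i j| <= th.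
Proof.
move=> Ap Ath.
have Aii k : 0 < A k k by exact: posdef_diag_gt0.
have [->|ij] := eqVneq i j.
  rewrite gtr0_norm//; have := Ath (delta_mx ord0 j).
  by rewrite qform_delta !mxE eqxx mulr1n subr_ge0.
have QM (M : 'M[R]_n) (s : R) : qform M (delta_mx ord0 i + s *: delta_mx ord0 j) =
    M i i + s ^+ 2 * M j j + s * (M i j + M j i).
  rewrite /qform [_^T]linearD linearZ/= !trmx_delta !mulmxDl !mulmxDr.
  by rewrite -!scalemxAl -!scalemxAr -!rowE -!colE !mxE; ring.
have Q (s : R) : qform (th%:M - A) (delta_mx ord0 i + s *: delta_mx ord0 j) =
    th - A i i + s ^+ 2 * (th - A j j) - 2 * s * A i j.
  have Aji : A j i = A i j by rewrite -{1}Ap.1 mxE.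
  rewrite QM !mxE !eqxx (negbTE ij) eq_sym (negbTE ij) Aji mulr1n mulr0n.
  ring.
have := Ath (delta_mx ord0 i + 1 *: delta_mx ord0 j).
have := Ath (delta_mx ord0 i + (-1) *: delta_mx ord0 j).
rewrite !Q => h1 h2; have := Aii i; have := Aii j => ? ?.
by rewrite ler_norml; apply/andP; split; nra.
Qed.

End Matrix.

(** * Taylor bounds from continuous partial derivatives *)

Section Calculus.
Context {R : realType}.

Section Directional.
Variables (V : normedModType R) (g : V -> R).

Lemma is_derive_line (y v : V) (a : R) : derivable g (y + a *: v) v ->
  is_derive a 1 (fun a : R => g (y + a *: v)) ('D_v g (y + a *: v)).
Proof.
have E : (fun h : R => h^-1 *: (g (y + (h *: 1 + a) *: v) - g (y + a *: v)))
    = (fun h : R => h^-1 *: (g (h *: v + (y + a *: v)) - g (y + a *: v))).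
  apply/funext => h; congr (_ *: (g _ - _)).
  by rewrite [h *: 1]mulr1 scalerDl addrCA.
move=> dg; split; last by rewrite /derive /comp/= /shift/= E.
by move: dg; rewrite /derivable /shift/= E.
Qed.

Lemma mvt_line (y v : V) (h : R) :
  (forall a : R, `|a| <= `|h| -> derivable g (y + a *: v) v) ->
  exists2 a : R, `|a| <= `|h| &
    g (y + h *: v) - g y = h * 'D_v g (y + a *: v).
Proof.
move=> dg; pose G a := g (y + a *: v).
have dG (a : R) : `|a| <= `|h| -> is_derive a 1 G ('D_v g (y + a *: v)).
  by move=> ah; apply: is_derive_line; exact: dg.
have cG (a b : R) : (forall c, c \in `[a, b] -> `|c| <= `|h|) ->
    {within `[a, b], continuous G}.
  move=> ab; apply: derivable_within_continuous => c cab.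
  by have [] := dG _ (ab _ cab).
have G0 : G 0 = g y by rewrite /G scale0r addr0.
have [h0|h0|->] := ltgtP h 0; last first.
- by exists 0; rewrite ?normr0// scale0r addr0 subrr mul0r.
- have H c : c \in `[0, h] -> `|c| <= `|h|.
    by rewrite in_itv/= => /andP[c0 ch]; rewrite !ger0_norm// (le_trans c0).
  have [|c cI Ec] := @MVT _ G (fun c => 'D_v g (y + c *: v)) _ _ h0 _ (cG _ _ H).
    by move=> c cI; apply/dG/H; exact: subset_itv_oo_cc cI.
  have ch : `|c| <= `|h| by apply: H; exact: subset_itv_oo_cc cI.
  by exists c => //; rewrite -G0 [LHS]Ec subr0 mulrC.
- have H c : c \in `[h, 0] -> `|c| <= `|h|.
    by rewrite in_itv/= => /andP[c0 ch]; rewrite !ler0_norm ?lerN2 ?(le_trans c0).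
  have [|c cI Ec] := @MVT _ G (fun c => 'D_v g (y + c *: v)) _ _ h0 _ (cG _ _ H).
    by move=> c cI; apply/dG/H; exact: subset_itv_oo_cc cI.
  have ch : `|c| <= `|h| by apply: H; exact: subset_itv_oo_cc cI.
  by exists c => //; rewrite -G0 -[LHS]opprB -/(G h) Ec sub0r mulrN opprK mulrC.
Qed.

(* Uniform in the base point, hence additive in the direction [w]: this turns
   continuous partial derivatives into a chain rule along lines. *)
Definition strict_derive (x w : V) (l : R) : Prop :=
  forall e : R, 0 < e -> exists2 d : R, 0 < d & forall (y : V) (h : R),
    `|y - x| < d -> `|h| < d -> `|g (y + h *: w) - g y - h * l| <= e * `|h|.

Lemma strict_derive0 x : strict_derive x 0 0.
Proof.
move=> e e0; exists 1 => // y h _ _.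
by rewrite scaler0 addr0 subrr mulr0 subr0 normr0 mulr_ge0// ltW.
Qed.

Lemma strict_deriveD x w1 w2 l1 l2 : strict_derive x w1 l1 ->
  strict_derive x w2 l2 -> strict_derive x (w1 + w2) (l1 + l2).
Proof.
move=> s1 s2 e e0; have e20 : 0 < e / 2 by rewrite divr_gt0.
have [d1 d10 D1] := s1 _ e20; have [d2 d20 D2] := s2 _ e20.
have w0 : 0 < 1 + `|w1| by rewrite ltr_pwDl.
(* The second bound keeps the shifted base point [y + h w1] within [d2] of [x], where the estimate
   for [w2] applies. *)
pose d := Num.min d1 (d2 / 2 / (1 + `|w1|)).
have d0 : 0 < d by rewrite lt_min d10 !divr_gt0.
exists d => // y h; rewrite !lt_min => /andP[y1 y2] /andP[h1 h2].
have d2w : d2 / 2 / (1 + `|w1|) <= d2 / 2.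
  by rewrite ler_pdivrMr// ler_peMr ?lerDl// divr_ge0// ltW.
have hw : `|h| * `|w1| < d2 / 2.
  move: h2; rewrite ltr_pdivlMr// mulrDr mulr1; apply: le_lt_trans.
  by rewrite lerDr.
have Y2 : `|y + h *: w1 - x| < d2.
  by rewrite addrAC (le_lt_trans (ler_normD _ _))// normrZ; lra.
have -> : g (y + h *: (w1 + w2)) - g y - h * (l1 + l2) =
  (g (y + h *: w1 + h *: w2) - g (y + h *: w1) - h * l2)
  + (g (y + h *: w1) - g y - h * l1) by rewrite scalerDr addrA; ring.
apply: (le_trans (ler_normD _ _)).
have A1 := D1 _ _ y1 h1; have A2 : `|h| < d2 by lra.
have := D2 _ _ Y2 A2; lra.
Qed.

(** By the mean value theorem along [v], the increment is an intermediate value of ['D_v g] times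
    the step, and continuity at [x] makes that value close to ['D_v g x] uniformly in the base
    point. *)
Lemma strict_deriveZ x v (c : R) :
  (\forall z \near x, derivable g z v) -> {for x, continuous ('D_v g)} ->
  strict_derive x (c *: v) (c * 'D_v g x).
Proof.
move=> dg cg e e0; have c0 : 0 < 1 + `|c| by rewrite ltr_pwDl.
have /nbhs_normP[d1 /= d10 D1] := dg.
have ec : 0 < e / (1 + `|c|) by rewrite divr_gt0.
have /cvgrPdist_le/(_ _ ec)/nbhs_normP[d2 /= d20 D2] := cg.
pose r := Num.min d1 d2; have r0 : 0 < r by rewrite lt_min d10.
pose d := Num.min (r / 2) (r / 2 / (1 + `|c|) / (1 + `|v|)).
have v0 : 0 < 1 + `|v| by rewrite ltr_pwDl.
have d0 : 0 < d by rewrite lt_min !divr_gt0.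
exists d => // y h; rewrite !lt_min => /andP[y1 _] /andP[_ h2].
have in_r (a : R) : `|a| <= `|h * c| -> `|x - (y + a *: v)| < r.
  move=> ah; rewrite opprD addrA (le_lt_trans (ler_normB _ _))// normrZ distrC.
  suff : `|a| * `|v| <= r / 2 by lra.
  move: h2; rewrite ltr_pdivlMr// ltr_pdivlMr// => h2.
  apply: (le_trans _ (ltW h2)); rewrite normrM in ah.
  have hc : `|h| * `|c| <= `|h| * (1 + `|c|) by rewrite ler_wpM2l// lerDr.
  have ? := normr_ge0 h.
  rewrite mulrAC; apply: ler_pM => //; last by rewrite lerDr.
  exact: le_trans hc.
have [a ah Ea] : exists2 a : R, `|a| <= `|h * c| &
    g (y + (h * c) *: v) - g y = h * c * 'D_v g (y + a *: v).
  by apply: mvt_line => a /in_r; rewrite lt_min => /andP[+ _]; exact: D1.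
rewrite scalerA Ea -mulrA -mulrBr -mulrBr !normrM mulrC.
apply: ler_wpM2r => //.
move: (in_r _ ah); rewrite lt_min => /andP[_ /D2]; rewrite /= distrC.
rewrite ler_pdivlMr// mulrDr mulr1 mulrC => B.
by apply: le_trans B; rewrite lerDr.
Qed.


Lemma strict_derive_is_derive x w l : strict_derive x w l -> is_derive x w g l.
Proof.
move=> sd.
have cv : (fun h : R => h^-1 *: ((g \o shift x) (h *: w) - g x)) @ 0^' --> l.
  apply/cvgrPdist_le => e e0; have [d d0 D] := sd _ e0.
  near=> h; have h0 : h != 0 by near: h; exact: nbhs_dnbhs_neq.
  have hd : `|h| < d.
    by near: h; apply: dnbhs0_lt.
  have := D x h; rewrite subrr normr0 => /(_ d0 hd).
  rewrite /shift/= [x + _]addrC => le.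
  rewrite -(ler_pM2r (_ : 0 < `|h|)) ?normr_gt0// -normrM mulrBl.
  by rewrite [_ *: _]mulrC mulfVK// distrC [l * h]mulrC.
by split; [apply/cvg_ex; exists l|exact: cvg_lim cv].
Unshelve. all: by end_near. Qed.

End Directional.

Definition partial n (i : 'I_n) (g : 'rV[R]_n -> R) : 'rV[R]_n -> R :=
  'D_(delta_mx ord0 i) g.

Definition C1_at n (g : 'rV[R]_n -> R) (x : 'rV[R]_n) : Prop :=
  forall i, (\forall z \near x, derivable g z (delta_mx ord0 i)) /\
            {for x, continuous (partial i g)}.

Lemma C1_is_derive n (g : 'rV[R]_n -> R) x w : C1_at g x ->
  is_derive x w g (\sum_i w ord0 i * partial i g x).
Proof.
move=> Cg; apply: strict_derive_is_derive.
rewrite [X in strict_derive g x X _]row_sum_delta.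
apply: (big_ind2 (strict_derive g x)).
- exact: strict_derive0.
- by move=> *; exact: strict_deriveD.
- by move=> i _; apply: strict_deriveZ; have [] := Cg i.
Qed.

Lemma C1_is_derive_line n (g : 'rV[R]_n -> R) x w (a : R) : C1_at g (x + a *: w) ->
  is_derive a 1 (fun a : R => g (x + a *: w))
    (\sum_i w ord0 i * partial i g (x + a *: w)).
Proof.
move=> /(C1_is_derive w) [dg <-]; exact: is_derive_line.
Qed.

(** Subtracting the quadratic with second derivative [m] leaves [K], whose derivative at [c] equals
    [(G2 c' - m) * c >= 0] by a second use of the mean value theorem. *)
Lemma taylor2_lower (G G1 G2 : R -> R) (m : R) :
  (forall a : R, 0 <= a <= 1 -> is_derive a 1 G (G1 a)) ->
  (forall a : R, 0 <= a <= 1 -> is_derive a 1 G1 (G2 a)) ->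
  (forall a : R, 0 <= a <= 1 -> m <= G2 a) -> G 0 + G1 0 + m / 2 <= G 1.
Proof.
move=> dG dG1 mG2.
pose K a := G a - (G1 0 * a + m / 2 * a ^+ 2).
have dK (a : R) : 0 <= a <= 1 -> is_derive a 1 K (G1 a - (G1 0 + m * a)).
  move=> /dG dGa; by apply: is_derive_eq; rewrite /GRing.scale /=; field.
have sub (c b : R) : 0 <= b <= 1 -> c \in `[0, b] -> 0 <= c <= 1.
  by move=> b01; rewrite in_itv/= => ?; lra.
have sub1 (c : R) : c \in `[0, 1] -> 0 <= c <= 1 by rewrite in_itv.
have [c /sub1 c01 Kc] : exists2 c, c \in `[0, 1] &
    K 1 - K 0 = (G1 c - (G1 0 + m * c)) * (1 - 0).
  apply: (@MVT_segment _ K (fun a => G1 a - (G1 0 + m * a))) => //.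
    by move=> c cI; apply/dK/sub1; exact: subset_itv_oo_cc cI.
  by apply: derivable_within_continuous => c /sub1/dK[].
have [c' c'c G1c] : exists2 c', c' \in `[0, c] & G1 c - G1 0 = G2 c' * (c - 0).
  apply: (@MVT_segment _ G1 G2) => //; first by lra.
    by move=> z zI; apply: dG1; apply: (sub _ _ c01); exact: subset_itv_oo_cc zI.
  by apply: derivable_within_continuous => z /(sub _ _ c01)/dG1[].
have := mG2 _ (sub _ _ c01 c'c) => mc.
move: Kc; rewrite /K expr0n expr1n !mulr0 !addr0 !mulr1 !subr0.
have : 0 <= (G2 c' - m) * c by rewrite mulr_ge0//; lra.
lra.
Qed.

Lemma taylor2_upper (G G1 G2 : R -> R) (m : R) :
  (forall a : R, 0 <= a <= 1 -> is_derive a 1 G (G1 a)) ->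
  (forall a : R, 0 <= a <= 1 -> is_derive a 1 G1 (G2 a)) ->
  (forall a : R, 0 <= a <= 1 -> G2 a <= m) -> G 1 <= G 0 + G1 0 + m / 2.
Proof.
move=> dG dG1 mG2.
have := @taylor2_lower (fun a => - G a) (fun a => - G1 a) (fun a => - G2 a) (- m).
have H1 (a : R) : 0 <= a <= 1 -> is_derive a 1 (fun a => - G a) (- G1 a).
  by move=> /dG ?; exact: is_deriveN.
have H2 (a : R) : 0 <= a <= 1 -> is_derive a 1 (fun a => - G1 a) (- G2 a).
  by move=> /dG1 ?; exact: is_deriveN.
have H3 (a : R) : 0 <= a <= 1 -> - m <= - G2 a by move=> /mG2; rewrite lerN2.
by move=> /(_ H1 H2 H3); lra.
Qed.

Definition hess n (g : 'rV[R]_n -> R) (x : 'rV[R]_n) : 'M[R]_n :=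
  \matrix_(i, j) partial i (partial j g) x.

Definition C2_at n (g : 'rV[R]_n -> R) (x : 'rV[R]_n) : Prop :=
  C1_at g x /\ forall i, C1_at (partial i g) x.

Lemma is_derive_gradient_line n (g : 'rV[R]_n -> R) x w (a : R) :
  C2_at g (x + a *: w) ->
  is_derive a 1 (fun a : R => \sum_i w ord0 i * partial i g (x + a *: w))
    (qform (hess g (x + a *: w)) w).
Proof.
move=> [_ C1g].
have -> : (fun a : R => \sum_i w ord0 i * partial i g (x + a *: w)) =
    \sum_i (w ord0 i *: (fun a : R => partial i g (x + a *: w))).
  by apply/funext => b; rewrite fct_sumE.
have -> : qform (hess g (x + a *: w)) w = \sum_i w ord0 i *:
    (\sum_j w ord0 j * partial j (partial i g) (x + a *: w)).
  rewrite /qform mxE; apply: eq_bigr => i _.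
  rewrite !mxE mulrC [RHS]/GRing.scale/=; congr (_ * _).
  by apply: eq_bigr => j _; rewrite !mxE.
apply: is_derive_sum => i; apply: is_deriveZ; exact: C1_is_derive_line.
Qed.

Lemma norm_delta_mx n (i : 'I_n) : `|delta_mx ord0 i : 'rV[R]_n| <= 1.
Proof.
rewrite [leLHS]/Num.norm/= mx_normrE; apply/bigmax_leP; split => // -[k l] _ /=.
by rewrite !mxE ger0_norm// lern1 leq_b1.
Qed.

Lemma derive_shift (V : normedModType R) (g : V -> R) (c z v : V) :
  'D_v (fun z => g (z + c)) z = 'D_v g (z + c).
Proof.
rewrite /derive /comp /shift/=.
by under eq_fun do rewrite -addrA.
Qed.

Lemma derivable_shift (V : normedModType R) (g : V -> R) (c z v : V) :
  derivable g (z + c) v -> derivable (fun z => g (z + c)) z v.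
Proof.
rewrite /derivable /shift/=.
by under [X in _ -> cvg (X @ _)]eq_fun do rewrite -addrA.
Qed.

(** The mean value theorem is used twice: along [e_i] for the increment of [g] in direction [e_j],
    then along [e_j] for [partial i g]. *)
Lemma mvt_second_difference n (g : 'rV[R]_n -> R) x i j (h : R) : 0 < h ->
  (forall z, `|z - x| <= 2 * h -> derivable g z (delta_mx ord0 i) /\
     derivable (partial i g) z (delta_mx ord0 j)) ->
  exists2 z, `|z - x| <= 2 * h &
    g (x + h *: delta_mx ord0 i + h *: delta_mx ord0 j)
     - g (x + h *: delta_mx ord0 i) - g (x + h *: delta_mx ord0 j) + g x
    = h ^+ 2 * partial j (partial i g) z.
Proof.
move=> h0 dg; set ei := delta_mx ord0 i; set ej := delta_mx ord0 j.
have near2 (a b : R) : `|a| <= `|h| -> `|b| <= `|h| ->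
    `|x + a *: ei + b *: ej - x| <= 2 * h.
  rewrite (gtr0_norm h0) => ah bh.
  rewrite addrAC [x + _]addrC addrK (le_trans (ler_normD _ _))// !normrZ.
  have := ler_pM (normr_ge0 a) (normr_ge0 _) ah (norm_delta_mx i).
  have := ler_pM (normr_ge0 b) (normr_ge0 _) bh (norm_delta_mx j).
  by rewrite -/ei -/ej; lra.
have near1 (a : R) : `|a| <= `|h| -> `|x + a *: ei - x| <= 2 * h.
  move=> ah; have := near2 a 0 ah; rewrite scale0r addr0 normr0; exact.
pose F z := g (z + h *: ej) - g z.
have dF (a : R) : `|a| <= `|h| ->
    derivable (fun z => g (z + h *: ej)) (x + a *: ei) ei /\ derivable g (x + a *: ei) ei.
  move=> ah; split; last by have [] := dg _ (near1 _ ah).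
  by apply: derivable_shift; have [] := dg _ (near2 _ _ ah (lexx _)).
have [a ah Ea] : exists2 a : R, `|a| <= `|h| &
    F (x + h *: ei) - F x = h * 'D_ei F (x + a *: ei).
  by apply: mvt_line => a /dF[? ?]; exact: derivableB.
have [d1 d2] := dF _ ah.
rewrite deriveB// derive_shift in Ea.
have [b bh Eb] : exists2 b : R, `|b| <= `|h| &
    partial i g (x + a *: ei + h *: ej) - partial i g (x + a *: ei)
    = h * 'D_ej (partial i g) (x + a *: ei + b *: ej).
  by apply: mvt_line => b bh; have [] := dg _ (near2 _ _ ah bh).
exists (x + a *: ei + b *: ej); first exact: near2.
rewrite expr2 -mulrA -Eb -Ea /F; ring.
Qed.

(** The second difference is symmetric in [i] and [j], so the two mixed partials take a common value
    at two points near [x]. With [e] half of the supposed gap at [x], continuity makes this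
    impossible. *)
Lemma schwarz n (g : 'rV[R]_n -> R) x i j :
  (\forall z \near x, C2_at g z) ->
  partial i (partial j g) x = partial j (partial i g) x.
Proof.
move=> C2g; have [C1x C2x] := nbhs_singleton C2g.
have cij := (C2x j i).2; have cji := (C2x i j).2.
apply/eqP/negPn/negP => neq.
pose e := `|partial i (partial j g) x - partial j (partial i g) x| / 2.
have e0 : 0 < e by rewrite divr_gt0// normr_gt0 subr_eq0.
have /nbhs_normP[d1 /= d10 D1] := C2g.
have /cvgrPdist_lt/(_ _ e0)/nbhs_normP[d2 /= d20 D2] := cij.
have /cvgrPdist_lt/(_ _ e0)/nbhs_normP[d3 /= d30 D3] := cji.
pose d := Num.min d1 (Num.min d2 d3).
have d0 : 0 < d by rewrite !lt_min d10 d20.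
have D z : `|x - z| < d -> [/\ C2_at g z,
  `|partial i (partial j g) x - partial i (partial j g) z| < e &
  `|partial j (partial i g) x - partial j (partial i g) z| < e].
  rewrite !lt_min => /and3P[z1 z2 z3]; split.
  - exact: D1.
  - exact: D2.
  - exact: D3.
clearbody d.
pose h := d / 4; have h0 : 0 < h by rewrite divr_gt0.
have nd z : `|z - x| <= 2 * h -> `|x - z| < d.
  move=> zh; rewrite distrC; apply: (le_lt_trans zh).
  by rewrite /h mulrCA gtr_pMr// ltr_pdivrMr// mul1r ltr_nat.
have dg k l z : `|z - x| <= 2 * h -> derivable g z (delta_mx ord0 k) /\
    derivable (partial k g) z (delta_mx ord0 l).
  move=> /nd/D[[C1z C2z] _ _]; split.
    by have [/nbhs_singleton] := C1z k.
  by have [/nbhs_singleton] := C2z k l.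
have [z zh Ez] := mvt_second_difference h0 (dg i j).
have [z' zh' Ez'] := mvt_second_difference h0 (dg j i).
have E : partial j (partial i g) z = partial i (partial j g) z'.
  apply: (@mulfI _ (h ^+ 2)); first by rewrite expf_neq0// gt_eqF.
  by rewrite -Ez -Ez' [x + h *: delta_mx ord0 i + _]addrAC; ring.
have [_ _ B1] := D _ (nd _ zh); have [_ B2 _] := D _ (nd _ zh').
rewrite E in B1.
move: B1 B2; rewrite /e.
move: (partial i (partial j g) x) (partial j (partial i g) x)
  (partial i (partial j g) z') => p q s; clear.
by have := ler_distD s p q; rewrite [`|s - q|]distrC; lra.
Qed.

End Calculus.

(** * Local behaviour of test functions *)

Section Local.
(* Otherwise failing unifications unfold iterated derivatives. *)
#[local] Opaque derive derivable.
Context {R : realType}.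

Lemma nbhs_pair_norm n (x : 'rV[R]_n) (t : R) (P : 'rV[R]_n -> R -> Prop) :
  (\forall p \near (x, t), P p.1 p.2) ->
  exists2 r : R, 0 < r & forall z s, `|z - x| < r -> `|s - t| < r -> P z s.
Proof.
move=> /nbhs_ballP[r /= r0 rP]; exists r => // z s zx st.
apply: (rP (z, s)); split => /=; rewrite -ball_normE /ball_/= distrC//.
Qed.

Lemma norm_rV_le n (v : 'rV[R]_n) (m : R) : 0 <= m ->
  (forall i, `|v ord0 i| <= m) -> `|v| <= m.
Proof.
move=> m0 vm; rewrite [leLHS]/Num.norm/= mx_normrE; apply/bigmax_leP.
by split => // -[k l] _ /=; rewrite ord1.
Qed.

(** Dividing by [n+1] rather than [n] leaves a positive tolerance for the entries in dimension 0 as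
    well. *)
Lemma qform_entries_le n (M : 'M[R]_n) (m : R) w : 0 <= m ->
  (forall i j, `|M i j| <= m / n.+1%:R) -> `|qform M w| <= m * sqnorm w.
Proof.
move=> m0 Mm; rewrite qformE.
pose k := m / n.+1%:R; have k0 : 0 <= k by rewrite divr_ge0.
have wij i j : `|M i j * (w ord0 i * w ord0 j)| <=
    k / 2 * w ord0 i ^+ 2 + k / 2 * w ord0 j ^+ 2.
  rewrite normrM (le_trans (ler_wpM2r (normr_ge0 _) (Mm i j)))// -/k normrM.
  rewrite -[w ord0 i ^+ 2]real_normK ?num_real// -[w ord0 j ^+ 2]real_normK ?num_real//.
  have := sqr_ge0 (`|w ord0 i| - `|w ord0 j|); nra.
apply: le_trans (ler_norm_sum _ _ _) _.
apply: (@le_trans _ _ (\sum_(i < n) \sum_(j < n)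
    (k / 2 * w ord0 i ^+ 2 + k / 2 * w ord0 j ^+ 2))).
  apply: ler_sum => i _; apply: le_trans (ler_norm_sum _ _ _) _.
  by apply: ler_sum => j _; exact: wij.
under eq_bigr do rewrite big_split/= -mulr_sumr sumr_const card_ord -/(sqnorm w).
rewrite big_split/= sumr_const card_ord -!mulr_sumr sumrMnl -/(sqnorm w).
have -> : k / 2 * (sqnorm w *+ n) + (k / 2 * sqnorm w) *+ n = k * n%:R * sqnorm w.
  by field.
apply: ler_wpM2r; first exact: sqnorm_ge0.
rewrite /k -mulrA ler_piMr// mulrC ler_pdivrMr// mul1r ler_nat.
exact: leqnSn.
Qed.

Lemma cont_on_section n (Omega : set 'rV[R]_n) t1 t2 (g : 'rV[R]_n -> R -> R) x s :
  cont_on Omega t1 t2 g -> inD Omega t1 t2 x s ->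
  {for x, continuous (fun y => g y s)}.
Proof.
move=> cg xs; have := cg _ _ xs; apply: (@cvg_comp _ _ _
  (fun y : 'rV[R]_n => (y, s)) (fun p : 'rV[R]_n * R => g p.1 p.2)).
apply: (@cvg_pair _ _ _ (nbhs x) (nbhs x) (nbhs s) _ _ _ id (fun=> s)); [exact: cvg_id|exact: cvg_cst].
Qed.

Lemma hessianE n (g : 'rV[R]_n -> R -> R) x t i j :
  hessian g x t i j = dx i (dx j g) x t.
Proof. exact: mxE. Qed.

Lemma le_dist_eq (a b a' b' k : R) : a = a' -> b = b' ->
  `|a' - b'| <= k -> `|a - b| <= k.
Proof. by move=> -> ->. Qed.

Lemma hessian_entry_dist n (g : 'rV[R]_n -> R -> R) x y t s i j (k : R) :
  `|dx i (dx j g) x t - dx i (dx j g) y s| <= k ->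
  `|hessian g x t i j - hessian g y s i j| <= k.
Proof. exact: le_dist_eq (hessianE _ _ _ _ _) (hessianE _ _ _ _ _). Qed.

Lemma sub_mxE n m (A B : 'M[R]_(n, m)) i j : (A - B) i j = A i j - B i j.
Proof. by rewrite !mxE. Qed.

Lemma convex_slope (a b c h : R) : a <= h * b + (1 - h) * c -> a - c <= (b - c) * h.
Proof. lra. Qed.

Lemma difference_quotient_bounds (a b d m s t : R) : 0 < t - s ->
  `|d - (s - t)^-1 *: (a - b)| <= m ->
  (- d - m) * (t - s) <= a - b <= (- d + m) * (t - s).
Proof.
move=> ts; have -> : (s - t)^-1 *: (a - b) = - ((a - b) / (t - s)).
  by rewrite -[s - t]opprB invrN scaleNr [_ *: _]mulrC.
rewrite opprK ler_norml => /andP[h1 h2].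
by apply/andP; split; [rewrite -ler_pdivlMr|rewrite -ler_pdivrMr] => //; lra.
Qed.

Lemma half_min_lt (a b : R) : 0 < a -> 0 < b ->
  let h := Num.min a b / 2 in 0 < h /\ h < a /\ h < b.
Proof.
move=> a0 b0 h; rewrite /h; have m0 : 0 < Num.min a b by rewrite lt_min a0.
have := ge_min a a b; have := ge_min b a b; rewrite !lexx orbT /= => ma mb.
by split; [lra|split; lra].
Qed.

Lemma perturbed_lt0 (q N : R) : q < 0 -> 0 <= N -> q + - q / (2 * (N + 1)) * N < 0.
Proof.
move=> q0 N0; have -> : q + - q / (2 * (N + 1)) * N = q * (N + 2) / (2 * (N + 1)).
  by field; rewrite gt_eqF//; lra.
by rewrite pmulr_llt0 ?invr_gt0 ?pmulr_llt0//; lra.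
Qed.

Lemma time_dist_lt (s t r0 r : R) : t - r0 < s <= t -> r0 <= r -> `|s - t| < r.
Proof. by move=> /andP[? ?] ?; rewrite ler0_norm; lra. Qed.

Lemma time_itvW (s t r0 r : R) : t - r0 < s <= t -> r0 <= r -> t - r < s <= t.
Proof. by move=> /andP[? ?] ?; apply/andP; split; lra. Qed.

Lemma half_slope_lt0 (d t h : R) : 0 < d -> 0 < h -> (- d + d / 2) * (t - (t - h)) < 0.
Proof. by move=> d0 h0; nra. Qed.

#[local] Opaque qform sqnorm hessian.

Section TestFun.
Variables (n : nat) (Omega : set 'rV[R]_n) (t1 t2 : R).
Hypothesis oOmega : open Omega.
Variable phi : 'rV[R]_n -> R -> R.
Hypothesis testphi : test_fun Omega t1 t2 phi.
Local Notation inD := (inD Omega t1 t2).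

Lemma inD_near x t : inD x t -> exists2 r : R, 0 < r &
  forall z s, `|z - x| < r -> `|s - t| < r -> inD z s.
Proof.
move=> [Ox /andP[tl tu]].
have /nbhs_normP[r /= r0 rO] : nbhs x Omega by exact: open_nbhs_nbhs.
exists (Num.min r (Num.min (t - t1) (t2 - t))).
  by rewrite !lt_min r0 !subr_gt0 tl tu.
move=> z s; rewrite !lt_min => /andP[zr _] /and3P[_ s1 s2]; split.
  by apply: rO; rewrite /= distrC.
by move: s1 s2; rewrite !ltr_norml => /andP[? _] /andP[_ ?]; apply/andP; split; lra.
Qed.

Lemma test_C2_at x s : inD x s -> C2_at (fun y => phi y s) x.
Proof.
move=> [Ox st]; have [_ [dphi _ c1 c2 _]] := testphi.
have nO : nbhs x Omega by exact: open_nbhs_nbhs.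
split=> [i|i j]; split.
- by apply: filterS nO => z Oz; have [d1 _ _] := dphi z s (conj Oz st); exact: d1.
- exact: (cont_on_section (c1 i)).
- by apply: filterS nO => z Oz; have [_ d2 _] := dphi z s (conj Oz st); exact: d2.
- exact: (cont_on_section (c2 j i)).
Qed.

Lemma hessian_near x t (m : R) : inD x t -> 0 < m -> exists2 r : R, 0 < r &
  forall z s, `|z - x| < r -> `|s - t| < r -> inD z s /\
    forall w, `|qform (hessian phi z s) w - qform (hessian phi x t) w| <= m * sqnorm w.
Proof.
move=> xt m0; have [r0 r00 rD] := inD_near xt.
have [_ [_ _ _ c2 _]] := testphi.
have [r1 r10 r1H] : exists2 r : R, 0 < r & forall z s, `|z - x| < r ->
    `|s - t| < r -> forall i j, `|hessian phi z s i j - hessian phi x t i j| <= m / n.+1%:R.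
  apply: (@nbhs_pair_norm n x t (fun z s => forall i j,
    `|hessian phi z s i j - hessian phi x t i j| <= m / n.+1%:R)).
  have mn : 0 < m / n.+1%:R by rewrite divr_gt0.
  have H i j : \forall p \near (x, t),
      `|hessian phi p.1 p.2 i j - hessian phi x t i j| <= m / n.+1%:R.
    have /cvgrPdistC_le/(_ _ mn) := c2 i j x t xt.
    by apply: filterS => p; exact: hessian_entry_dist.
  exact: (filter_forall _ (fun i => filter_forall _ (H i))).
exists (Num.min r0 r1); first by rewrite lt_min r00.
move=> z s; rewrite !lt_min => /andP[z0 z1] /andP[s0 s1]; split; first exact: rD.
move=> w; rewrite -qformB; apply: qform_entries_le; first exact: ltW.
by move=> i j; rewrite sub_mxE; exact: r1H.
Qed.

Lemma taylor_near x t (m : R) : inD x t -> 0 < m -> exists2 r : R, 0 < r &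
  forall (w : 'rV[R]_n) (s : R), `|w| < r -> `|s - t| < r ->
  phi x s + \sum_i w ord0 i * dx i phi x s + qform (hessian phi x t - m%:M) w / 2
    <= phi (x + w) s
    <= phi x s + \sum_i w ord0 i * dx i phi x s + qform (hessian phi x t + m%:M) w / 2.
Proof.
move=> xt m0; have [r r0 rH] := hessian_near xt m0; exists r => // w s wr sr.
pose g y := phi y s.
have near_w (a : R) : 0 <= a <= 1 -> `|x + a *: w - x| < r.
  move=> /andP[a0 a1]; rewrite addrC addKr normrZ ger0_norm//.
  by apply: le_lt_trans wr; rewrite ler_piMl.
have C2 (a : R) : 0 <= a <= 1 -> C2_at g (x + a *: w).
  by move=> /near_w aw; apply: test_C2_at; have [] := rH _ _ aw sr.
have dG (a : R) : 0 <= a <= 1 -> is_derive a 1 (fun a => g (x + a *: w))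
    (\sum_i w ord0 i * partial i g (x + a *: w)).
  by move=> /C2[C1 _]; exact: C1_is_derive_line.
have dG1 (a : R) : 0 <= a <= 1 ->
    is_derive a 1 (fun a => \sum_i w ord0 i * partial i g (x + a *: w))
      (qform (hess g (x + a *: w)) w).
  by move=> /C2; exact: is_derive_gradient_line.
have qb (a : R) : 0 <= a <= 1 -> qform (hessian phi x t - m%:M) w
    <= qform (hess g (x + a *: w)) w <= qform (hessian phi x t + m%:M) w.
  move=> /near_w aw; have [_ /(_ w)] := rH _ _ aw sr.
  have -> : hess g (x + a *: w) = hessian phi (x + a *: w) s by [].
  by rewrite qformB qformD !qform_scalar ler_distl.
have := @taylor2_lower _ _ _ _ (qform (hessian phi x t - m%:M) w) dG dG1
  (fun a a01 => (andP (qb a a01)).1).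
have := @taylor2_upper _ _ _ _ (qform (hessian phi x t + m%:M) w) dG dG1
  (fun a a01 => (andP (qb a a01)).2).
by rewrite scale0r scale1r addr0 => -> ->.
Qed.

(** Tangent plane inequality: the chord slope over [h] in [(0, 1]] is at most the slope over the
    whole segment, and [h] tends to [0] from the right. *)
Lemma convex_near x t : inD x t -> exists2 r : R, 0 < r &
  forall (w : 'rV[R]_n) (s : R), `|w| < r -> `|s - t| < r ->
  phi x s + \sum_i w ord0 i * dx i phi x s <= phi (x + w) s.
Proof.
move=> xt; have [r r0 rD] := inD_near xt; exists r => // w s wr sr.
have near_w (a : R) : 0 <= a <= 1 -> inD (x + a *: w) s.
  move=> /andP[a0 a1]; apply: rD => //; rewrite addrC addKr normrZ ger0_norm//.
  by apply: le_lt_trans wr; rewrite ler_piMl.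
have [_ st] : inD x s by have := near_w 0; rewrite scale0r addr0; apply; lra.
have [[_ cvx _] _] := testphi.
pose g y := phi y s.
have C1 : C1_at g x.
  have : inD x s by have := near_w 0; rewrite scale0r addr0; apply; lra.
  by move=> /test_C2_at[].
have [dg Dg] := C1_is_derive w C1.
suff : 'D_w g x <= g (x + w) - g x by rewrite Dg -lerBrDl.
have cv : (fun h : R => h^-1 *: ((g \o shift x) (h *: w) - g x)) @ 0^'+ --> 'D_w g x.
  by apply: cvg_dnbhs_at_right.
apply: (ler_cvg_to cv (cvg_cst _)); near=> h.
have h0 : 0 < h by [].
have h1 : h <= 1 by near: h; exact: nbhs_right_le.
rewrite [_ *: _]mulrC ler_pdivrMr// /shift/=.
have E (k : R) : k *: (x + w) + (1 - k) *: x = x + k *: w.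
  by rewrite scalerDr addrAC -scalerDl addrCA subrr addr0 scale1r.
rewrite /g [h *: w + x]addrC; apply: convex_slope; rewrite -E; apply: cvx => //.
  by move=> k k01; rewrite E; have [] := near_w _ k01.
by rewrite (ltW h0).
Unshelve. all: by end_near. Qed.


Lemma dt_near x t (m : R) : inD x t -> 0 < m -> exists2 r : R, 0 < r &
  forall s : R, t - r < s <= t ->
  (- dt phi x t - m) * (t - s) <= phi x s - phi x t <= (- dt phi x t + m) * (t - s).
Proof.
move=> xt m0; have [_ [dphi _ _ _ _]] := testphi.
have [_ _ dd] := dphi _ _ xt.
have cv : (fun h : R => h^-1 *: (((fun s => phi x s) \o shift t) (h *: 1)
    - phi x t)) @ 0^' --> dt phi x t by exact: dd.
have /cvgrPdist_le/(_ _ m0)/nbhs_normP[r /= r0 rP] := cv.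
exists r => // s /andP[s1 s2].
have [->|st] := eqVneq s t; first by rewrite !subrr !mulr0 lexx.
have ts : 0 < t - s by rewrite subr_gt0 lt_neqAle st.
have h0 : s - t != 0 by rewrite subr_eq0.
have hr : `|0 - (s - t)| < r by rewrite sub0r opprB gtr0_norm// ltrBlDr -ltrBlDl.
have := rP _ hr h0; rewrite /shift/= [(s - t) *: 1]mulr1 subrK.
exact: difference_quotient_bounds.
Qed.

Lemma phi_time_ge x t : inD x t -> exists2 r : R, 0 < r &
  forall s : R, t - r < s <= t -> 0 <= phi x s - phi x t.
Proof.
move=> [Ox /andP[lt ut]]; have [[_ _ mono] _] := testphi.
exists (t - t1); first by rewrite subr_gt0.
by move=> s; rewrite opprB addrCA subrr addr0 => /andP[? ?]; rewrite subr_ge0 mono.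
Qed.

Lemma dt_le0 x t : inD x t -> dt phi x t <= 0.
Proof.
move=> xt; rewrite leNgt; apply/negP => d0.
have [r1 r10 r1P] := phi_time_ge xt.
have d20 : 0 < dt phi x t / 2 by rewrite divr_gt0.
have [r2 r20 r2P] := dt_near xt d20.
pose h := Num.min r1 r2 / 2.
have [h0 [hr1 hr2]] : 0 < h /\ h < r1 /\ h < r2 by exact: half_min_lt.
have := r1P (t - h); rewrite ltrD2l ltrN2 hr1 gerBl (ltW h0) => /(_ isT).
have := r2P (t - h); rewrite ltrD2l ltrN2 hr2 gerBl (ltW h0) => /(_ isT)/andP[_].
move=> /[swap] /le_trans /[apply].
by rewrite leNgt half_slope_lt0.
Qed.

(** Symmetry is Schwarz's theorem. If the form were negative at [v], the upper Taylor bound at a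
    small multiple of [v] would fall below the tangent plane, against convexity. *)
Lemma hessian_possemidef x t : inD x t -> sym_possemidef (hessian phi x t).
Proof.
move=> xt; split.
  apply/matrixP => i j; rewrite mxE !hessianE.
  apply: schwarz; have [Ox st] := xt.
  have nO : nbhs x Omega by exact: open_nbhs_nbhs.
  by apply: filterS nO => z Oz; apply: test_C2_at.
move=> v; rewrite leNgt; apply/negP => q0.
(* Small enough that the form of [H + m I] is still negative at [v]. *)
pose m := - qform (hessian phi x t) v / (2 * (sqnorm v + 1)).
have v1 : 0 < 2 * (sqnorm v + 1) by rewrite mulr_gt0// ltr_wpDl ?sqnorm_ge0.
have m0 : 0 < m by rewrite divr_gt0// oppr_gt0.
have [r1 r10 r1P] := taylor_near xt m0.
have [r2 r20 r2P] := convex_near xt.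
pose h := Num.min r1 r2 / 2.
have [h0 [hr1 hr2]] : 0 < h /\ h < r1 /\ h < r2 by exact: half_min_lt.
have n0 : 0 < `|v| + 1 by rewrite ltr_wpDl.
pose a := h / (`|v| + 1); have a0 : 0 < a by rewrite divr_gt0.
have ah : `|a *: v| <= h.
  by rewrite normrZ gtr0_norm// /a mulrAC ler_pdivrMr// ler_wpM2l ?lerDl// ltW.
have tt (r : R) : 0 < r -> `|t - t| < r by rewrite subrr normr0.
have /andP[_] := r1P _ _ (le_lt_trans ah hr1) (tt _ r10).
have := r2P _ _ (le_lt_trans ah hr2) (tt _ r20).
move=> /le_trans /[apply]; rewrite lerDl pmulr_lge0// qformZ.
rewrite pmulr_rge0 ?exprn_gt0// qformD qform_scalar.
apply/negP; rewrite -ltNge /m; move: q0 (sqnorm_ge0 v).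
exact: perturbed_lt0.
Qed.

Lemma test_fun_near x t (m : R) : inD x t -> 0 < m -> exists2 r : R, 0 < r &
  (forall (w : 'rV[R]_n) (s : R), `|w| < r -> t - r < s <= t ->
    [/\ phi x s + \sum_i w ord0 i * dx i phi x s <= phi (x + w) s,
     phi x s + \sum_i w ord0 i * dx i phi x s + qform (hessian phi x t - m%:M) w / 2
      <= phi (x + w) s &
     phi (x + w) s <=
     phi x s + \sum_i w ord0 i * dx i phi x s + qform (hessian phi x t + m%:M) w / 2])
  /\ (forall s : R, t - r < s <= t ->
    [/\ 0 <= phi x s - phi x t,
     (- dt phi x t - m) * (t - s) <= phi x s - phi x t &
     phi x s - phi x t <= (- dt phi x t + m) * (t - s)]).
Proof.
move=> xt m0.
have [r1 r10 r1P] := taylor_near xt m0; have [r2 r20 r2P] := convex_near xt.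
have [r3 r30 r3P] := phi_time_ge xt; have [r4 r40 r4P] := dt_near xt m0.
pose r := Num.min (Num.min r1 r2) (Num.min r3 r4).
have [le1 le2] : r <= r1 /\ r <= r2 by rewrite /r !ge_min !lexx !orbT.
have [le3 le4] : r <= r3 /\ r <= r4 by rewrite /r !ge_min !lexx !orbT.
exists r; first by rewrite /r !lt_min r10 r20 r30.
split=> [w s wr ts|s].
  have w1 := lt_le_trans wr le1; have w2 := lt_le_trans wr le2.
  have /andP[? ?] := r1P w s w1 (time_dist_lt ts le1).
  by split => //; exact: r2P (time_dist_lt ts le2).
move=> ts; have /andP[? ?] := r4P s (time_itvW ts le4).
by split => //; exact: r3P (time_itvW ts le3).
Qed.

End TestFun.
End Local.

(** * Mean values of trapped functions and admissible pairs *)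

Section Averages.
Context {R : realType}.

Lemma quadratic_mxapp n (a : R) (p : 'I_n -> R) (K A : 'M[R]_n) y :
  qpoly a (fun j => \sum_i p i * A i j) (fun i j => (A^T *m K *m A) i j / 2) y
  = a + \sum_i mxapp A y ord0 i * p i + qform K (mxapp A y) / 2.
Proof.
rewrite /qpoly /mxapp qform_mulmx trmxK qformE; congr (_ + _ + _).
  under eq_bigr do rewrite mulr_suml.
  rewrite exchange_big/=; apply: eq_bigr => i _; rewrite mxE mulr_suml.
  by apply: eq_bigr => j _; rewrite mxE; ring.
rewrite mulr_suml; apply: eq_bigr => i _; rewrite mulr_suml; apply: eq_bigr => j _.
by rewrite mulrAC.
Qed.

Lemma mxapp_norm_le n (A : 'M[R]_n) (k e : R) y : 0 <= k -> 0 <= e ->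
  (forall i j, `|A i j| <= k) -> eball e y -> `|mxapp A y| <= n%:R * (e * k).
Proof.
move=> k0 e0 Ak ye.
have yi i : `|y ord0 i| <= e.
  rewrite -(ler_pXn2r (ltn0Sn 1)) ?nnegrE// real_normK ?num_real//.
  apply: le_trans (ltW ye); rewrite (bigD1 i)//= lerDl.
  by apply: sumr_ge0 => j _; exact: sqr_ge0.
apply: norm_rV_le => [|i]; first by rewrite !mulr_ge0.
rewrite mxE (le_trans (ler_norm_sum _ _ _))//.
apply: (@le_trans _ _ (\sum_(j < n) e * k)).
  by apply: ler_sum => j _; rewrite normrM mxE ler_pM.
by rewrite sumr_const card_ord mulr_natl.
Qed.

(** Substituting [w = A y] turns the form of [K] into that of [A^T K A], of which the ball average
    retains only the trace; the coefficients [p s] cancel at each time, so their dependence on [s]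
    is harmless. *)
Lemma parab_avg_quadratic_bounds n (v : 'rV[R]_n -> R -> R) A (b e : R) x t
    (p : R -> 'I_n -> R) (K K' : 'M[R]_n) (k k' r : R) : 0 < b -> 0 < e ->
  (forall y, eball e y -> `|mxapp A y| < r) -> b ^+ 2 / n.+2%:R * e ^+ 2 < r ->
  (forall (w : 'rV[R]_n) (s : R), `|w| < r -> t - r < s <= t ->
    v x s + \sum_i w ord0 i * p s i + qform K w / 2 <= v (x + w) s
      <= v x s + \sum_i w ord0 i * p s i + qform K' w / 2) ->
  (forall s : R, t - r < s <= t ->
    k * (t - s) <= v x s - v x t <= k' * (t - s)) ->
  v x t + e ^+ 2 / (2 * n.+2%:R) * (\tr (A^T *m K *m A) + b ^+ 2 * k)
    <= parab_avg v A b e x t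
    <= v x t + e ^+ 2 / (2 * n.+2%:R) * (\tr (A^T *m K' *m A) + b ^+ 2 * k').
Proof.
move=> b0 e0 Ar br vK vk.
have E (T c a : R) : a + e ^+ 2 / (2 * n.+2%:R) * (T + b ^+ 2 * c) =
    (a + e ^+ 2 / n.+2%:R * (T / 2)) + c * (b ^+ 2 / n.+2%:R * e ^+ 2 / 2).
  by field; rewrite -natrD pnatr_eq0.
rewrite !E; apply: parab_avg_bounds => // s sI.
have sr : t - r < s <= t.
  by move: sI => /andP[s1 ->]; rewrite andbT (lt_le_trans _ s1)// ltrD2l ltrN2.
have trE (M : 'M[R]_n) : \sum_i (A^T *m M *m A) i i / 2 = \tr (A^T *m M *m A) / 2.
  by rewrite -mulr_suml.
have vQ y : eball e y ->
    qpoly (v x s) (fun j => \sum_i p s i * A i j)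
      (fun i j => (A^T *m K *m A) i j / 2) y
    <= v (x + mxapp A y) s <=
    qpoly (v x s) (fun j => \sum_i p s i * A i j)
      (fun i j => (A^T *m K' *m A) i j / 2) y.
  by move=> ye; rewrite !quadratic_mxapp; exact: vK (Ar _ ye) sr.
have /andP[] := space_avg_bounds e0 vQ.
rewrite !trE; have /andP[] := vk _ sr.
move: (v x s) (v x t) (space_avg _ _ _ _ _) (e ^+ 2 / _ * _) (e ^+ 2 / _ * _).
by clear; move=> vs vt sa p1 p2 *; apply/andP; split; lra.
Qed.

(** Displacements are at most [n * e * psi e] and the time length is at most [(e * psi e)^2], so
    [e * psi e --> 0] brings all admissible pairs into the trap region at once. *)
Lemma admissible_geometry n (psi : R -> R) (r : R) : 0 < r ->
  (forall e : R, 0 < e -> 0 < psi e) -> e * psi e @[e --> 0^'+] --> (0 : R) ->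
  \forall e \near 0^'+, forall (A : 'M[R]_n) b, admissible psi e A b ->
    (forall y, eball e y -> `|mxapp A y| < r) /\ b ^+ 2 / n.+2%:R * e ^+ 2 < r.
Proof.
move=> r0 psi0 epsi.
(* The bound by 1 lets the square of [e * psi e] be estimated by [e * psi e] itself. *)
have rn : 0 < Num.min 1 (r / n.+1%:R) by rewrite lt_min ltr01 divr_gt0.
have /cvgr0Pnorm_lt/(_ _ rn) near_epsi := epsi.
near=> e; have e0 : 0 < e by [].
have pe := psi0 _ e0; have epe : 0 < e * psi e by rewrite mulr_gt0.
have : `|e * psi e| < Num.min 1 (r / n.+1%:R) by near: e.
rewrite gtr0_norm// lt_min => /andP[ep1 epr] A b [Ap [b0 [_ [Ale ble]]]].
rewrite ltr_pdivlMr// in epr; split=> [y ye|].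
  apply: (@le_lt_trans _ _ (n%:R * (e * psi e))).
    apply: mxapp_norm_le ye; [exact: ltW|exact: ltW|].
    by move=> i j; exact: entry_le_scalar.
  by apply: le_lt_trans epr; rewrite mulrC ler_wpM2l ?ler_nat// ltW.
apply: (@le_lt_trans _ _ (e * psi e * 1)).
  rewrite mulrAC -exprMn ler_pdivrMr// (@le_trans _ _ ((e * psi e) ^+ 2))//.
    by rewrite lerXn2r ?nnegrE ?mulr_ge0 ?(ltW b0) ?(ltW e0) ?(ltW pe)// mulrC ler_wpM2l// ltW.
  by rewrite mulr1 expr2 ler_wpM2l ?(ltW epe)// (le_trans (ltW ep1))// ler1n.
by rewrite mulr1; apply: le_lt_trans epr; rewrite ler_peMr ?(ltW epe)// ler1n.
Unshelve. all: by end_near. Qed.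

(** The divergence of [psi] enters here: a pair that does not depend on [e] eventually meets both
    size constraints. *)
Lemma admissible_near n (psi : R -> R) (A : 'M[R]_n) (b : R) :
  psi e @[e --> 0^'+] --> +oo -> sym_posdef A -> 0 < b -> b * \det A = 1 ->
  \forall e \near 0^'+, admissible psi e A b.
Proof.
move=> /cvgryPge psioo Ap b0 bA.
pose m := \sum_i \sum_j `|A i j| * n.+1%:R.
have m0 : 0 <= m by do 2 (apply: sumr_ge0 => ? _); rewrite mulr_ge0.
have Am v : qform A v <= m * sqnorm v.
  apply: (le_trans (ler_norm _)); apply: qform_entries_le => // i j.
  rewrite ler_pdivlMr// /m (bigD1 i)//= (bigD1 j)//= -addrA lerDl.
  by rewrite addr_ge0// ?sumr_ge0// => *; rewrite ?mulr_ge0// sumr_ge0// => *; rewrite mulr_ge0.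
near=> e.
have pm : m <= psi e by near: e; exact: psioo.
have pb : b <= psi e by near: e; exact: psioo.
split => //; split => //; split => //; split => // v.
rewrite qformB qform_scalar subr_ge0 (le_trans (Am v))// ler_wpM2r//.
exact: sqnorm_ge0.
Unshelve. all: by end_near. Qed.

End Averages.

(** * Expansion of the mean value operator *)

Section Expansion.
Context {R : realType}.

(** Continuity of the root, [D = 0] included, proved by comparing [(n+1)]-th powers; this needs
    nonnegative bases, hence the split on the sign of [geom_root n D - d]. The radius covers shifts
    [m] of both signs, one for each trap. *)
Lemma geom_root_near n (X : R -> R) (D d : R) : 0 <= D -> 0 < d ->
  X m @[m --> 0] --> D -> exists2 r : R, 0 < r & forall m : R, `|m| < r ->
    0 <= X m -> geom_root n D - d <= geom_root n (X m) <= geom_root n D + d.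
Proof.
move=> D0 d0 XD; have g0 := geom_root_ge0 n D.
have up : D < (geom_root n D + d) ^+ n.+1.
  by rewrite -{1}(geom_rootK n D0) ltrXn2r ?nnegrE ?addr_ge0 ?ltrDl ?(ltW d0).
have nup : \forall m \near 0, X m <= (geom_root n D + d) ^+ n.+1.
  by apply: filterS (cvgr_lt D XD _ up) => m; exact: ltW.
have nlo : \forall m \near 0, geom_root n D - d < 0 \/ (geom_root n D - d) ^+ n.+1 <= X m.
  have [lt0|ge0] := ltP (geom_root n D - d) 0; first by near=> m; left.
  have lo : (geom_root n D - d) ^+ n.+1 < D.
    by rewrite -{2}(geom_rootK n D0) ltrXn2r ?nnegrE// gtrBl.
  by apply: filterS (cvgr_gt D XD _ lo) => m /ltW; right.
have /nbhs_normP[r1 /= r10 up1] := nup; have /nbhs_normP[r2 /= r20 lo1] := nlo.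
exists (Num.min r1 r2); first by rewrite lt_min r10.
move=> m; rewrite lt_min => /andP[m1 m2] Xm; apply/andP; split.
  have [|lt0|le] := lo1 m; first by rewrite /= sub0r normrN.
    by rewrite (le_trans (ltW lt0))// geom_root_ge0.
  have [lt0|ge0] := ltP (geom_root n D - d) 0.
    by rewrite (le_trans (ltW lt0))// geom_root_ge0.
  by rewrite le_geom_root.
rewrite geom_root_le ?addr_ge0 ?(ltW d0)//; apply: up1.
by rewrite /= sub0r normrN.
Unshelve. all: by end_near. Qed.

Lemma shifted_det_cvg n (H : 'M[R]_n) (c : R) :
  (c + m) * \det (H + m%:M) @[m --> 0] --> c * \det H.
Proof.
apply: cvgM; last exact: det_addscalar_cvg.
by rewrite -[X in _ --> X]addr0; apply: cvgD; [exact: cvg_cst|exact: cvg_id].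
Qed.

Definition quadratic_trap n (v : 'rV[R]_n -> R -> R) x t (p : R -> 'I_n -> R)
    (r : R) (K : 'M[R]_n) (k : R) (K' : 'M[R]_n) (k' : R) : Prop :=
  (forall (w : 'rV[R]_n) (s : R), `|w| < r -> t - r < s <= t ->
    v x s + \sum_i w ord0 i * p s i + qform K w / 2 <= v (x + w) s
      <= v x s + \sum_i w ord0 i * p s i + qform K' w / 2) /\
  (forall s : R, t - r < s <= t ->
    k * (t - s) <= v x s - v x t <= k' * (t - s)).

Lemma quotient_dist_le (P I k D F d e : R) : 0 < e -> 0 <= k <= 1 -> 0 <= d ->
  P + e ^+ 2 * (k * (D - d)) <= I <= P + e ^+ 2 * (k * (D + d)) ->
  `|k * (D - F) - (- P + (I - k * F * e ^+ 2)) / e ^+ 2| <= d.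
Proof.
move=> e0 /andP[k0 k1] d0 /andP[I1 I2].
have e20 : 0 < e ^+ 2 by rewrite exprn_gt0.
have -> : k * (D - F) - (- P + (I - k * F * e ^+ 2)) / e ^+ 2
    = k * D - (I - P) / e ^+ 2 by field; exact: lt0r_neq0.
have J1 : k * (D - d) <= (I - P) / e ^+ 2 by rewrite ler_pdivlMr//; lra.
have J2 : (I - P) / e ^+ 2 <= k * (D + d) by rewrite ler_pdivrMr//; lra.
have kd : k * d <= d by rewrite ler_piMl.
by rewrite ler_norml; apply/andP; split; lra.
Qed.

Section TestFun.
Variables (n : nat) (Omega : set 'rV[R]_n) (t1 t2 : R).
Hypothesis oOmega : open Omega.
Variable phi : 'rV[R]_n -> R -> R.
Hypothesis testphi : test_fun Omega t1 t2 phi.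
Variables (x : 'rV[R]_n) (t : R).
Hypothesis xt : inD Omega t1 t2 x t.

Local Notation H := (hessian phi x t).
Local Notation c := (- dt phi x t).
Local Notation D := (c * \det H).
Local Notation trap := (quadratic_trap phi x t (fun s i => dx i phi x s)).

Lemma monge_ampere_ge0 : 0 <= D.
Proof.
rewrite mulr_ge0 ?oppr_ge0 ?(dt_le0 testphi xt)//.
exact/possemidef_det_ge0/(hessian_possemidef oOmega testphi xt).
Qed.

(** The positive shift [m] provides an optimal pair even for degenerate [H] or [c = 0]. The pair
    depends on [d] alone among the small parameters, which is what [admissible_near] asks for. *)
Lemma trap_upper (d : R) : 0 < d ->
  exists r K k K' k', [/\ 0 < r, trap r K k K' k' &
    exists A b, [/\ sym_posdef A, 0 < b, b * \det A = 1 &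
      \tr (A^T *m K' *m A) + b ^+ 2 * k' <= n.+1%:R * (geom_root n D + d)]].
Proof.
move=> d0; have Hp := hessian_possemidef oOmega testphi xt.
have c0 : 0 <= c by rewrite oppr_ge0 (dt_le0 testphi xt).
have [r0 r00 rX] := geom_root_near n monge_ampere_ge0 d0 (@shifted_det_cvg n H c).
pose m := r0 / 2; have m0 : 0 < m by rewrite divr_gt0.
have mr : `|m| < r0 by rewrite gtr0_norm// gtr_pMr// invf_lt1// ltr1n.
have HP := possemidefD m0 Hp; have cm : 0 < c + m by rewrite ltr_wpDl.
have /andP[_ Xm] := rX m mr (ltW (mulr_gt0 cm (posdef_det_gt0 HP))).
have [A [b [Ap b0 bA E]]] := posdef_trace_agm_eq HP cm.
have [r rp [rw rs]] := test_fun_near oOmega testphi xt m0.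
exists r, (H - m%:M), (c - m), (H + m%:M), (c + m); split => //.
  split=> [w s ws sr|s sr].
    by have [_ lo up] := rw w s ws sr; apply/andP; split.
  by have [_ lo up] := rs s sr; apply/andP; split.
by exists A, b; split => //; rewrite E ler_wpM2l.
Qed.

Lemma trap_lower (d : R) : 0 < d ->
  exists r K k K' k', [/\ 0 < r, trap r K k K' k' &
    forall A b, sym_posdef A -> 0 < b -> b * \det A = 1 ->
      n.+1%:R * (geom_root n D - d) <= \tr (A^T *m K *m A) + b ^+ 2 * k].
Proof.
move=> d0; have Hp := hessian_possemidef oOmega testphi xt.
have c0 : 0 <= c by rewrite oppr_ge0 (dt_le0 testphi xt).
have [D0|D0] := eqVneq D 0.
  (* For degenerate [H] the matrix [H - m I] is not semidefinite, and large [A] could make its trace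
     term very negative. As [D = 0], the required bound is nonpositive and [K = 0], [k = 0] suffice;
     the upper half of the trap is arbitrary, so the tolerance is 1. *)
  have [r rp [rw rs]] := test_fun_near oOmega testphi xt ltr01.
  exists r, 0, 0, (H + 1%:M), (c + 1); split => //.
    split=> [w s ws sr|s sr].
      have [lo _ up] := rw w s ws sr; rewrite up andbT.
      by rewrite /qform mulmx0 mul0mx mxE mul0r addr0.
    by have [lo _ up] := rs s sr; rewrite mul0r lo.
  move=> A b _ _ _; rewrite D0 mulmx0 mul0mx linear0 mulr0 addr0.
  rewrite /geom_root powR0 ?invr_eq0 ?pnatr_eq0// sub0r mulrN oppr_le0.
  by rewrite mulr_ge0// ltW.
have detH : \det H != 0 by apply: contraNneq D0 => ->; rewrite mulr0.
have c_gt0 : 0 < c by rewrite lt_def c0 andbT; apply: contraNneq D0 => ->; rewrite mul0r.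
have HP := possemidef_posdef Hp detH.
have [r1 r10 HB] := posdefB HP.
have [r0 r00 rX] := geom_root_near n monge_ampere_ge0 d0 (@shifted_det_cvg n H c).
(* Below [r0] the root moves by at most [d]; below [r1] and [c] the shifted matrix and time
   coefficient stay positive, as [trace_agm] requires. *)
pose m := Num.min (Num.min r0 r1) c / 2.
have [m0 [mr01 mc]] : 0 < m /\ m < Num.min r0 r1 /\ m < c.
  by apply: half_min_lt => //; rewrite lt_min r00.
have /andP[mr0 mr1] : (m < r0) && (m < r1) by rewrite -lt_min.
have HmP := HB _ m0 mr1; have cm : 0 < c - m by rewrite subr_gt0.
have mr : `|- m| < r0 by rewrite normrN gtr0_norm.
have Xm : geom_root n D - d <= geom_root n ((c - m) * \det (H - m%:M)).
  have HN : H - m%:M = H + (- m)%:M by rewrite raddfN.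
  have := rX _ mr; rewrite -HN => /(_ (ltW (mulr_gt0 cm (posdef_det_gt0 HmP)))).
  by move=> /andP[].
have [r rp [rw rs]] := test_fun_near oOmega testphi xt m0.
exists r, (H - m%:M), (c - m), (H + m%:M), (c + m); split => //.
  split=> [w s ws sr|s sr].
    by have [_ lo up] := rw w s ws sr; apply/andP; split.
  by have [_ lo up] := rs s sr; apply/andP; split.
move=> A b Ap b0 bA; apply: le_trans (trace_agm HmP Ap b0 cm bA).
by rewrite ler_wpM2l.
Qed.

Variables (psi : R -> R) (f : 'rV[R]_n -> R -> R).
Hypothesis psi_gt0 : forall e : R, 0 < e -> 0 < psi e.
Hypothesis psi_oo : psi e @[e --> 0^'+] --> +oo.
Hypothesis epsi0 : e * psi e @[e --> 0^'+] --> (0 : R).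

Let kappa : R := n.+1%:R / (2 * n.+2%:R).

Let kappaE (e T : R) : e ^+ 2 / (2 * n.+2%:R) * (n.+1%:R * T) = e ^+ 2 * (kappa * T).
Proof. by rewrite /kappa; field; rewrite -natrD pnatr_eq0. Qed.

Let kappa01 : 0 <= kappa <= 1.
Proof.
rewrite divr_ge0//= ler_pdivrMr// mul1r -natrM ler_nat.
by rewrite mul2n -addnn -addSnnS ltnW// ltn_addr.
Qed.

Lemma Meps_expansion :
  (- phi x t + Meps psi f phi e x t) / e ^+ 2 @[e --> 0^'+] -->
  kappa * (geom_root n D - geom_root n (f x t)).
Proof.
apply/cvgrPdist_le => d d0.
have [r [K [k [K' [k' [r0 [tw ts] lo]]]]]] := trap_lower d0.
have [q [L [l [L' [l' [q0 [uw us] [A [b [Ap b0 bA up]]]]]]]]] := trap_upper d0.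
have admA := admissible_near psi_oo Ap b0 bA.
have geo_r := @admissible_geometry R n psi r r0 psi_gt0 epsi0.
have geo_q := @admissible_geometry R n psi q q0 psi_gt0 epsi0.
near=> e; have e0 : 0 < e by [].
have ge_r : forall (A : 'M[R]_n) b, admissible psi e A b ->
    (forall y, eball e y -> `|mxapp A y| < r) /\ b ^+ 2 / n.+2%:R * e ^+ 2 < r.
  by near: e.
have ge_q : forall (A : 'M[R]_n) b, admissible psi e A b ->
    (forall y, eball e y -> `|mxapp A y| < q) /\ b ^+ 2 / n.+2%:R * e ^+ 2 < q.
  by near: e.
have aA : admissible psi e A b by near: e.
pose S := [set z : R | exists (A : 'M[R]_n) (b : R),
  admissible psi e A b /\ z = parab_avg phi A b e x t].
have c0 : 0 <= e ^+ 2 / (2 * n.+2%:R) by rewrite divr_ge0// sqr_ge0.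
have Slo z : S z -> phi x t + e ^+ 2 * (kappa * (geom_root n D - d)) <= z.
  move=> [A' [b' [aA' ->]]]; have [g1 g2] := ge_r _ _ aA'.
  have [A'p [b'0 [bA' _]]] := aA'.
  have /andP[+ _] := parab_avg_quadratic_bounds b'0 e0 g1 g2 tw ts.
  by apply: le_trans; rewrite -kappaE lerD2l ler_wpM2l// lo.
have SA : S (parab_avg phi A b e x t) by exists A, b.
have Sup : parab_avg phi A b e x t
    <= phi x t + e ^+ 2 * (kappa * (geom_root n D + d)).
  have [g1 g2] := ge_q _ _ aA.
  have /andP[_ le1] := parab_avg_quadratic_bounds b0 e0 g1 g2 uw us.
  by apply: (le_trans le1); rewrite -kappaE lerD2l ler_wpM2l.
apply: quotient_dist_le => //; first exact: ltW.
(* The real [inf] is meaningful only for a nonempty set bounded below: the pair from [trap_upper]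
   gives an element and [trap_lower] a bound valid for every admissible pair. *)
apply/andP; split.
  by apply: lb_le_inf; [exists (parab_avg phi A b e x t)|exact: Slo].
apply: le_trans Sup; apply: ge_inf SA.
by exists (phi x t + e ^+ 2 * (kappa * (geom_root n D - d))) => z; exact: Slo.
Unshelve. all: by end_near. Qed.

End TestFun.

(** Once the quotient converges, the one-sided [o(eps^2)] conditions see only the sign of the limit:
    [- q] lies below its positive part, and conversely [- q e <= d - L <= d] eventually. *)
Lemma negpart_cvg0 (q : R -> R) (L : R) : q e @[e --> 0^'+] --> L ->
  ((fun e => Num.max (- q e) 0) @ 0^'+ --> (0 : R)) <-> 0 <= L.
Proof.
move=> qL; split=> [cv|L0].
  rewrite -oppr_le0; apply: (ler_cvg_to (cvgN qL) cv).
  by near=> e; rewrite le_max lexx.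
apply/cvgrPdist_le => d d0; move/cvgrPdist_le : qL => /(_ _ d0).
apply: filterS => e; rewrite ler_norml => /andP[_ h].
rewrite sub0r normrN ger0_norm ?le_max ?lexx ?orbT// ge_max (ltW d0) andbT.
by apply: le_trans h; rewrite lerDr.
Unshelve. all: by end_near. Qed.

Lemma le_plus_oP (g : R -> R) (L : R) : g e / e ^+ 2 @[e --> 0^'+] --> L ->
  le_plus_o 0 g <-> 0 <= L.
Proof.
move=> gL; rewrite -(negpart_cvg0 gL) /le_plus_o.
suff E : {near 0^'+, (fun e => Num.max (0 - g e) 0 / e ^+ 2) =1
                     (fun e => Num.max (- (g e / e ^+ 2)) 0)}.
  by split; apply: cvg_trans; apply: near_eq_cvg; apply: filterS E => e ->.
near=> e; have e0 : 0 < e by [].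
by rewrite sub0r -mulNr -{2}[0](mul0r (e ^- 2)) maxr_pMl// invr_ge0 sqr_ge0.
Unshelve. all: by end_near. Qed.

Lemma ge_plus_oP (g : R -> R) (L : R) : g e / e ^+ 2 @[e --> 0^'+] --> L ->
  ge_plus_o 0 g <-> L <= 0.
Proof.
move=> gL; have -> : ge_plus_o 0 g = le_plus_o 0 (fun e => - g e).
  by rewrite /ge_plus_o /le_plus_o; under eq_fun do rewrite subr0 -[g _]opprK -sub0r.
rewrite -oppr_ge0; apply: le_plus_oP.
by under eq_fun do rewrite mulNr; exact: cvgN.
Qed.

Lemma geom_root_mono n (a b : R) : 0 <= a -> 0 <= b ->
  (geom_root n a <= geom_root n b) = (a <= b).
Proof. by move=> a0 b0; rewrite geom_root_le ?geom_root_ge0// geom_rootK. Qed.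

End Expansion.

Unset Implicit Arguments.

Theorem theorem2p5 (R : realType) (n : nat) (Omega : set 'rV[R]_n) (t1 t2 : R)
    (f : 'rV[R]_n -> R -> R) (psi : R -> R) (u : 'rV[R]_n -> R -> R) :
  open Omega -> t1 < t2 ->
  cont_on Omega t1 t2 f ->
  (forall x t, inD Omega t1 t2 x t -> 0 <= f x t) ->
  (forall e : R, 0 < e -> 0 < psi e) ->
  psi e @[e --> 0^'+] --> +oo ->
  e * psi e @[e --> 0^'+] --> (0 : R) ->
  parab_convex Omega t1 t2 u ->
  (visc_sol Omega t1 t2 f u <-> amvp_visc Omega t1 t2 psi f u).
Proof.
move=> oO _ _ f0 psi0 psioo epsi cvu.
pose k : R := n.+1%:R / (2 * n.+2%:R).
have k0 : 0 < k by rewrite divr_gt0.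
(* Both notions test the same functions touching at the same points, so it suffices to compare their
   conclusions for each [phi], [x], [t]; strict monotonicity of the root removes the exponents. *)
have equiv phi x t : test_fun Omega t1 t2 phi -> inD Omega t1 t2 x t ->
  (le_plus_o 0 (fun e => - phi x t + Meps psi f phi e x t)
     <-> f x t <= - dt phi x t * \det (hessian phi x t)) /\
  (ge_plus_o 0 (fun e => - phi x t + Meps psi f phi e x t)
     <-> - dt phi x t * \det (hessian phi x t) <= f x t).
  move=> tphi xt; have E := @Meps_expansion R n Omega t1 t2 oO phi tphi x t xt psi f psi0 psioo epsi.
  rewrite (le_plus_oP E) (ge_plus_oP E) pmulr_rge0// pmulr_rle0//.
  by rewrite subr_ge0 subr_le0 !geom_root_mono ?(monge_ampere_ge0 oO tphi xt) ?f0.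
split=> [[_ vs] x t xt phi tphi|am].
  have [eq1 eq2] := equiv _ _ _ tphi xt; have [vmax vmin] := vs _ _ xt _ tphi.
  by split=> sl ux; [apply/eq2; exact: vmin|apply/eq1; exact: vmax].
split=> // x t xt phi tphi.
have [eq1 eq2] := equiv _ _ _ tphi xt; have [amin amax] := am _ _ xt _ tphi.
by split=> sl ux; [apply/eq1; exact: amax|apply/eq2; exact: amin].
Qed.
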